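(* Let $n\ge 2$, $d\ge1$ be integers, $d_1=\lceil (d+1)/2\rceil$, $\mathcal{A}\in\mathtt{S}^d(\mathbb{R}^n)$, $y=\phi(\mathcal{A})$, and let $R\in\Sigma[\bar x]_{2d_1}$ be a generic SOS polynomial. For $k\ge d_1$ consider the semidefinite program $$(P_k)\qquad \min\ \langle R,z\rangle\quad\text{s.t.}\quad z_\alpha=\langle\bar x^\alpha(e^Tx)^{d-|\alpha|},y\rangle\ \text{ for } \alpha\in\mathbb{N}_d^{n-1},\quad z\in\mathcal{S}[\overline{\Delta}]_{2k}.$$ (i) If $\mathcal{A}$ is not completely positive, then $(P_k)$ is infeasible for all $k$ large enough. (ii) If $\mathcal{A}$ is completely positive, then $(P_k)$ has a minimizer for each $k\ge d_1$. Moreover, denoting by $z^{*,k}$ a minimizer of $(P_k)$, there exists $t\ge d_1$ such that the sequence of truncations $z^{*,k}|_{2t}$ ($k\ge t$) is bounded and every accumulation point $\hat z$ of it satisfies $\operatorname{rank}M_t[\hat z]=\operatorname{rank}M_{t-1}[\hat z]$.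
   Context: Write $x=(x_1,\dots,x_n)$, $\bar n=n-1$, $\bar x=(x_1,\dots,x_{n-1})$; $e$ is the all-ones vector of appropriate length. For $\alpha\in\mathbb{N}^m$ let $|\alpha|=\alpha_1+\cdots+\alpha_m$; $\mathbb{N}_d^m=\{\alpha\in\mathbb{N}^m:|\alpha|\le d\}$, $\overline{\mathbb{N}}_d^n=\{\alpha\in\mathbb{N}^n:|\alpha|=d\}$. Vectors labelled by multi-indices act on polynomials by $\langle\sum_\alpha p_\alpha x^\alpha,y\rangle=\sum_\alpha p_\alpha y_\alpha$ (likewise for polynomials in $\bar x$). $\mathtt{S}^d(\mathbb{R}^n)$ is the space of real symmetric tensors of order $d$ over $\mathbb{R}^n$. A tensor $\mathcal{A}\in\mathtt{S}^d(\mathbb{R}^n)$ is completely positive (CP) if $\mathcal{A}=\sum_{i=1}^r (v_i)^{\otimes d}$ for some $v_1,\dots,v_r\in\mathbb{R}_+^n$, where $(v^{\otimes d})_{i_1\ldots i_d}=v_{i_1}\cdots v_{i_d}$. The linear isomorphism $\phi:\mathtt{S}^d(\mathbb{R}^n)\to\mathbb{R}^{\overline{\mathbb{N}}_d^n}$ is $\phi(\mathcal{A})_\alpha=\mathcal{A}_{i_1\ldots i_d}$ whenever $x^\alpha=x_{i_1}\cdots x_{i_d}$. $\Sigma[\bar x]$ is the cone of sums of squares of polynomials in $\mathbb{R}[\bar x]$, and $\Sigma[\bar x]_{2k}=\Sigma[\bar x]\cap\mathbb{R}[\bar x]_{2k}$, where $\mathbb{R}[\bar x]_{2k}$ is the set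 of polynomials of degree at most $2k$. ''Generic $R\in\Sigma[\bar x]_{2d_1}$'' means: for all $R\in\Sigma[\bar x]_{2d_1}$ outside a subset of Lebesgue measure zero. For $z\in\mathbb{R}^{\mathbb{N}_{2k}^{\bar n}}$ and $q\in\mathbb{R}[\bar x]_{2k}$, the localizing matrix $L_q^{(k)}[z]$ is the symmetric matrix, indexed by monomials of degree at most $k-\lceil\deg(q)/2\rceil$, with $\langle qa^2,z\rangle=\mathrm{vec}(a)^TL_q^{(k)}[z]\,\mathrm{vec}(a)$ for all $a\in\mathbb{R}[\bar x]$ with $\deg(qa^2)\le2k$ ($\mathrm{vec}(a)$ is the coefficient vector of $a$); $M_k[z]=L_1^{(k)}[z]$ is the $k$th order moment matrix. $\mathcal{S}[\overline{\Delta}]_{2k}$ is the set of $z\in\mathbb{R}^{\mathbb{N}_{2k}^{\bar n}}$ with $M_k[z]\succeq0$, $L_{x_i}^{(k)}[z]\succeq0$ ($i=1,\dots,n-1$), $L_{1-e^T\bar x}^{(k)}[z]\succeq0$, $L_{1-\|\bar x\|^2}^{(k)}[z]\succeq0$. The truncation $z|_{2t}$ is the subvector $(z_\alpha)_{\alpha\in\mathbb{N}_{2t}^{\bar n}}$. *)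

(* Defs.v *)
From HB Require Import structures.
From mathcomp Require Import all_boot all_order all_algebra all_fingroup.
From mathcomp Require Import all_classical all_reals all_analysis.
(* The notations of mpoly clash with those of MathComp-Analysis, so monomials
   and coefficients are written mpolyX R a and mcoeff a p. *)
From mathcomp Require ssrcomplements mpoly.
Export -(notations) mpoly.
Export numFieldNormedType.Exports.

Set Implicit Arguments.
Unset Strict Implicit.
Unset Printing Implicit Defensive.

Import Order.TTheory GRing.Theory Num.Theory.
Local Open Scope classical_set_scope.
Local Open Scope ring_scope.

Section Tensors.
Context {R : realType}.

Definition tensor (d n : nat) := {ffun d.-tuple 'I_n -> R}.

Definition symmetric_tensor d n (A : tensor d n) :=
  forall (s : 'S_d) (t : d.-tuple 'I_n), A [tuple tnth t (s i) | i < d] = A t.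

Definition tensor_pow d n (v : 'rV[R]_n) : tensor d n :=
  [ffun t : d.-tuple 'I_n => \prod_(j < d) v 0 (tnth t j)].

Definition completely_positive d n (A : tensor d n) :=
  exists (r : nat) (v : 'I_r -> 'rV[R]_n),
    (forall j i, 0 <= v j 0 i) /\ A = \sum_(j < r) tensor_pow d (v j).

Definition var n (i : 'I_n) : mpoly n R := mpolyX R (mnm1 i).

(* A vector labelled by the multi-indices of degree d is encoded as a function
   on all multi-indices; phi A vanishes off degree d.  By phiE the choice of
   the tuple is immaterial when A is symmetric. *)
Definition phi d n (A : tensor d n) (a : multinom n) : R :=
  if [pick t : d.-tuple 'I_n | mpolyX R a == \prod_(i <- t) var i] is Some t
  then A t else 0.

Lemma prod_varE n (s : seq 'I_n) :
  \prod_(i <- s) var i = mpolyX R (Multinom [tuple count_mem i s | i < n]).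
Proof.
elim: s => [|x s IHs].
  by rewrite big_nil -[LHS]mpolyX0; congr mpolyX.
rewrite big_cons IHs /var -mpolyXD; congr mpolyX.
by apply/mnmP => i; rewrite mnmDE mnm1E !multinomE !tnth_mktuple /= eq_sym.
Qed.

Lemma mpolyX_inj n : injective (@mpolyX n R).
Proof.
move=> a b /(congr1 (mcoeff a)); rewrite !mcoeffX eqxx.
by case: eqVneq => // _ /eqP; rewrite oner_eq0.
Qed.

Lemma phiE d n (A : tensor d n) (a : multinom n) (t : d.-tuple 'I_n) :
  symmetric_tensor A -> mpolyX R a = \prod_(i <- t) var i -> phi A a = A t.
Proof.
move=> symA at_; rewrite /phi; case: pickP => [u /eqP au|/(_ t)]; last first.
  by rewrite at_ eqxx.
have /tuple_permP[s us] : perm_eq u t.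
  apply/allP => i _ /=; move: at_; rewrite au !prod_varE.
  move=> /mpolyX_inj/mnmP/(_ i); rewrite !multinomE !tnth_mktuple => ->.
  exact: eqxx.
by rewrite -[RHS](symA s); congr (A _); apply: val_inj.
Qed.

End Tensors.
Arguments tensor R d n : clear implicits.

Section Moments.
Context {R : realType} {m : nat}.

Definition pairing (p : mpoly m R) (w : multinom m -> R) : R :=
  \sum_(a <- msupp p) mcoeff a p * w a.

(* R^{N_e^m}, both for truncated moment sequences and for the coefficients of
   polynomials of degree at most e. *)
Definition tms (e : nat) := 'rV[R]_#|{: bmultinom m e.+1}|.

(* Extended by 0 to the multi-indices of degree greater than e. *)
Definition tms_at e (z : tms e) (a : multinom m) : R :=
  if insub a is Some b then z 0 (enum_rank (b : bmultinom m e.+1)) else 0.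

Definition truncate e e' (z : tms e) : tms e' :=
  \row_i tms_at z (bmnm (enum_val i)).

Definition coef_vec e (p : mpoly m R) : tms e :=
  \row_i mcoeff (bmnm (enum_val i)) p.

(* (msize q).-1 is the degree of q, and uphalf is n |-> ceil(n / 2). *)
Definition loc_order (q : mpoly m R) (k : nat) := (k - uphalf (msize q).-1)%N.

Definition localizing_mx (q : mpoly m R) (k : nat) (w : multinom m -> R) :
    'M[R]_#|{: bmultinom m (loc_order q k).+1}| :=
  \matrix_(i, j)
    pairing (q * mpolyX R (mnm_add (bmnm (enum_val i)) (bmnm (enum_val j)))) w.

Definition moment_mx (k : nat) (w : multinom m -> R) := localizing_mx 1 k w.

Definition psd_mx N (M : 'M[R]_N) :=
  M^T = M /\ forall v : 'cV[R]_N, 0 <= (v^T *m M *m v) 0 0.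

(* The set S[Delta-bar]_{2k}. *)
Definition simplex_tms (k : nat) (z : tms k.*2) :=
  let w := tms_at z in
  [/\ psd_mx (moment_mx k w),
      forall i : 'I_m, psd_mx (localizing_mx (var i) k w),
      psd_mx (localizing_mx (1 - \sum_(i < m) var i) k w) &
      psd_mx (localizing_mx (1 - \sum_(i < m) var i ^+ 2) k w)].

Definition is_sos (p : mpoly m R) :=
  exists s : seq (mpoly m R), p = \sum_(q <- s) q ^+ 2.

Definition sos_le (e : nat) (p : mpoly m R) :=
  is_sos p /\ (msize p <= e.+1)%N.

Lemma pairing_bound e (p : mpoly m R) w : (msize p <= e)%N ->
  pairing p w = \sum_(b : bmultinom m e) mcoeff b p * w b.
Proof.
move=> pe; pose I : subFinType _ := bmultinom m e.
rewrite /pairing (ssrcomplements.big_mksub I) ?msupp_uniq //=; last first.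
  by move=> a /msize_mdeg_lt /leq_trans; apply.
by rewrite big_rmcond //= => i /memN_msupp_eq0 ->; rewrite mul0r.
Qed.

Lemma pairingD (p q : mpoly m R) w :
  pairing (p + q) w = pairing p w + pairing q w.
Proof.
pose e := maxn (msize (p + q)) (maxn (msize p) (msize q)).
rewrite !(@pairing_bound e) ?leq_max ?leqnn ?orbT // -big_split /=.
by apply: eq_bigr => b _; rewrite mcoeffD mulrDl.
Qed.

Lemma pairingZ c (p : mpoly m R) w : pairing (c *: p) w = c * pairing p w.
Proof.
pose e := maxn (msize (c *: p)) (msize p).
rewrite !(@pairing_bound e) ?leq_max ?leqnn ?orbT // mulr_sumr.
by apply: eq_bigr => b _; rewrite mcoeffZ mulrA.
Qed.

Lemma pairing_sum (I : finType) (F : I -> mpoly m R) w :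
  pairing (\sum_i F i) w = \sum_i pairing (F i) w.
Proof.
apply: (big_morph (pairing^~ w)) => [p q|]; first exact: pairingD.
by rewrite -[0](scale0r 0) pairingZ mul0r.
Qed.

Lemma localizing_mxT q k w : (localizing_mx q k w)^T = localizing_mx q k w.
Proof.
apply/matrixP => i j; rewrite !mxE; congr (pairing (q * mpolyX R _) w).
by apply/mnmP => l; rewrite !mnmDE addnC.
Qed.

(* The defining identity <q a^2, z> = vec(a)^T L_q^(k)[z] vec(a). *)
Lemma localizing_mxP (q a : mpoly m R) k w :
  (msize a <= (loc_order q k).+1)%N ->
  let vec := \col_i mcoeff (bmnm (enum_val i)) a in
  pairing (q * a ^+ 2) w = (vec^T *m localizing_mx q k w *m vec) 0 0.
Proof.
move=> sa vec; pose I := bmultinom m (loc_order q k).+1.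
have -> : q * a ^+ 2 = \sum_(b : I) \sum_(c : I)
    (mcoeff b a * mcoeff c a) *: (q * mpolyX R (mnm_add b c)).
  rewrite expr2 [X in _ * (X * _)](mpolywE sa) [X in _ * (_ * X)](mpolywE sa).
  rewrite mulr_suml mulr_sumr; apply: eq_bigr => b _.
  rewrite !mulr_sumr; apply: eq_bigr => c _.
  by rewrite mpolyXD -scalerAl -!scalerAr scalerA.
rewrite pairing_sum mxE.
rewrite (reindex _ (onW_bij _ (enum_val_bij _))) /=; apply: eq_bigr => i _.
rewrite pairing_sum mxE mulr_suml.
rewrite (reindex _ (onW_bij _ (enum_val_bij _))) /=; apply: eq_bigr => j _.
rewrite !mxE pairingZ -mulrA mulrCA mulrC addmC.
by congr (_ * _); rewrite mulrC.
Qed.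

End Moments.
Arguments tms R m e : clear implicits.
Arguments truncate {R m e} e' z.
Arguments coef_vec {R m} e p.

(* Negligibility for N-dimensional Lebesgue measure, by countable covers with
   boxes of arbitrarily small total volume. *)
Definition lebesgue_null {R : realType} N (S : set 'rV[R]_N) :=
  forall eps : R, 0 < eps -> exists l u : nat -> 'rV[R]_N,
    [/\ forall j i, l j 0 i <= u j 0 i,
        S `<=` \bigcup_j [set v | forall i, l j 0 i <= v 0 i <= u j 0 i] &
        (\sum_(j <oo) (\prod_i (u j 0 i - l j 0 i))%:E <= eps%:E)%E].

Definition generic_sos {R : realType} m e (P : mpoly m R -> Prop) :=
  exists2 S : set (tms R m e), lebesgue_null S &
    forall p, sos_le e p -> ~ S (coef_vec e p) -> P p.
Arguments generic_sos {R} m e P.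

Section Program.
Context {R : realType} {n : nat}.

Definition bar_monomial (a : multinom n.-1) : mpoly n R :=
  \prod_(i < n.-1) var (widen_ord (leq_pred n) i) ^+ a i.

Definition Pk_feasible d (A : tensor R d n) k (z : tms R n.-1 k.*2) :=
  (forall a : multinom n.-1, (mdeg a <= d)%N ->
     tms_at z a =
     pairing (bar_monomial a * (\sum_(i < n) var i) ^+ (d - mdeg a)) (phi A))
  /\ simplex_tms z.

Definition Pk_minimizer d (A : tensor R d n) (p : mpoly n.-1 R) k
    (z : tms R n.-1 k.*2) :=
  Pk_feasible A z /\
  forall z' : tms R n.-1 k.*2, Pk_feasible A z' ->
    pairing p (tms_at z) <= pairing p (tms_at z').

End Program.

(* Main.v *)
Require Import Defs.
From mathcomp Require Import all_boot all_order all_algebra.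
From mathcomp Require Import all_classical all_reals all_analysis.
From mathcomp Require Import ring lra zify.

Set Implicit Arguments.
Unset Strict Implicit.
Unset Printing Implicit Defensive.

Import Order.TTheory GRing.Theory Num.Theory.
Local Open Scope classical_set_scope.
Local Open Scope ring_scope.

(** The idea.  Write [x_0, ..., x_m], with [m = n - 1], for the barycentric
    coordinates of the simplex: the variables of [R[x_bar]] together with
    [1 - e^T x_bar].  A truncated sequence [z] that meets the equality
    constraints of the program satisfies [A t = <x_(t_1) ... x_(t_d), z>] for
    every index tuple [t] ([moment_cond_tensor]).  All limits are taken along
    an ultrafilter on the orders [k].  The constraint on [1 - |x_bar|^2] bounds
    every entry of a feasible [z] by its entry at 0, which depends on [A] only
    ([moment_bound], [feasible_bound]); so feasible points of orders tending to
    infinity have pointwise limits, which are infinite sequences [w]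
    nonnegative on the quadratic module of the simplex.

    No representing measure is ever constructed.  What replaces it is that such
    a [w] is nonnegative on every polynomial that is nonnegative on the simplex
    ([simplex_positivity]).  First, [w] is nonnegative on all products of the
    [x_i]: for polynomials acting as positive commuting operators, products are
    positive ([op_nonnegM]).  Since the [x_i] sum to 1, the values of [w] on the
    words of length [N] are then the weights of an exchangeable random word, and
    the expectation of a monomial in the letter frequencies differs from the
    value of [w] on that monomial by [O(1/N)] ([word_weight_moments], a finite
    form of de Finetti's theorem).  The frequencies are points of the simplex,
    so this is a quadrature formula with nonnegative weights.

    Part (i): the same quadrature makes [A] a limit of completely positive
    tensors, and the completely positive cone is closed
    ([completely_positive_closed]).  So if the programs are feasible for
    arbitrarily large orders, then [A] is completely positive.

    Part (ii): minimizers exist by compactness.  Limits of minimizers minimize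
    [<R, w>] over the convex set of all simplex-nonnegative [w] that meet the
    equality constraints, since each such [w] truncates to a feasible point of
    every program ([feasible_of_functional]).  For a linear objective outside a
    null set, minimizers over a bounded set in finite dimension are unique,
    because the exceptional objectives lie in countably many Lipschitz graphs
    ([lebesgue_null_multiple_minimizers]); so all minimizing [w] agree up to
    degree [2 d_1 > d].  If [g] is [w]-orthogonal to all polynomials of degree
    at most [d], then [f |-> <(1 +- eps g) f, w>] meets the same constraints for
    small [eps], both signs are minimizers again, and uniqueness makes [g]
    orthogonal to degree [d + 1] as well ([minimizer_step]).  Hence the moment
    matrices of orders [d] and [d + 1] have the same rank ([flat_rank]), and
    [t = d + 1] works for every accumulation point. *)

(** * Polynomials acting as positive operators *)

Section OpNonneg.
Variables (R : realType) (m : nat) (w : multinom m -> R).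
Local Notation L p := (pairing p w).

Lemma pairing0 : L 0 = 0.
Proof. by rewrite -[0](scale0r (0 : mpoly m R)) pairingZ mul0r. Qed.

Lemma pairingN p : L (- p) = - L p.
Proof. by rewrite -scaleN1r pairingZ mulN1r. Qed.

Lemma pairingB p q : L (p - q) = L p - L q.
Proof. by rewrite pairingD pairingN. Qed.

Lemma pairing_bigsum (I : Type) (r : seq I) (P : pred I) F :
  L (\sum_(i <- r | P i) F i) = \sum_(i <- r | P i) L (F i).
Proof.
by apply: (big_morph (pairing^~ w)) => [p q|];
  [exact: pairingD|exact: pairing0].
Qed.

(** When [w] is nonnegative on squares it defines a (semi-)inner product, and
    this says that multiplication by [p] is a positive operator. *)
Definition op_nonneg (p : mpoly m R) := forall h, 0 <= L (p * h ^+ 2).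

Lemma op_nonneg_ge0 p : op_nonneg p -> 0 <= L p.
Proof. by move=> /(_ 1); rewrite expr1n mulr1. Qed.

Lemma op_nonnegD p q : op_nonneg p -> op_nonneg q -> op_nonneg (p + q).
Proof. by move=> hp hq h; rewrite mulrDl pairingD addr_ge0. Qed.

Lemma op_nonneg_sum (I : Type) (r : seq I) (P : pred I) F :
  (forall i, P i -> op_nonneg (F i)) -> op_nonneg (\sum_(i <- r | P i) F i).
Proof.
move=> hF; elim/big_ind: _ => //; last exact: op_nonnegD.
by move=> h; rewrite mul0r pairing0.
Qed.

(* The sequence p, p - p^2, ... from Riesz' proof that the product of two
   commuting positive operators is positive. *)
Let iterate p n := iter n (fun r : mpoly m R => r - r ^+ 2) p.

(** The interval 0 <= r <= 1 is stable under r |-> r - r^2, since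
    r - r^2 = (1 - r) r^2 + r (1 - r)^2 and 1 - (r - r^2) = (1 - r) + r^2. *)
Lemma op_nonneg_iterate p n : op_nonneg p -> op_nonneg (1 - p) ->
  op_nonneg (iterate p n) /\ op_nonneg (1 - iterate p n).
Proof.
move=> p0 p1; elim: n => [//|n [r0 r1]]; rewrite /= -/(iterate p n).
move: (iterate p n) r0 r1 => r r0 r1.
have one : op_nonneg 1.
  by have := op_nonnegD r0 r1; rewrite addrC subrK.
split=> h.
  have -> : (r - r ^+ 2) * h ^+ 2
      = (1 - r) * (r * h) ^+ 2 + r * ((1 - r) * h) ^+ 2 by ring.
  by rewrite pairingD addr_ge0.
have -> : (1 - (r - r ^+ 2)) * h ^+ 2 = (1 - r) * h ^+ 2 + 1 * (r * h) ^+ 2.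
  by ring.
by rewrite pairingD addr_ge0.
Qed.

Lemma iterate_telescope p n :
  p = \sum_(k < n) iterate p k ^+ 2 + iterate p n.
Proof.
elim: n => [|n IHn]; first by rewrite big_ord0 add0r.
rewrite {1}IHn big_ord_recr /= -/(iterate p n) -addrA; congr (_ + _).
by rewrite addrC subrK.
Qed.

(** Write [p] as the sum of the squares of the first [n] iterates plus the
    [n]-th iterate [p_n].  The squares contribute nonnegative terms to
    [L (p q h^2)], and [L ((p_n h)^2)] is the general term of a series bounded
    by [L (p h^2)], so by Cauchy-Schwarz the remainder [L (p_n q h^2)] tends
    to 0.  The product [p q] itself may lie outside the quadratic module. *)
Lemma op_nonnegM p q : op_nonneg p -> op_nonneg (1 - p) -> op_nonneg q ->
  op_nonneg (p * q).
Proof.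
move=> p0 p1 q0 h; rewrite leNgt; apply/negP => neg.
pose del := - L (p * q * h ^+ 2).
have del0 : 0 < del by rewrite oppr_gt0.
have one : op_nonneg 1.
  by have := op_nonnegD p0 p1; rewrite addrC subrK.
pose C := L (1 * (q * h) ^+ 2).
have C0 : 0 <= C by exact: one.
(* Minimizing a + 2 s b + s^2 C over s calls for s = del / C; the shift by 1
   covers C = 0. *)
pose s : R := del / (C + 1).
have C1 : 0 < C + 1 by lra.
have s0 : 0 < s by rewrite divr_gt0.
have sC : s * C <= del.
  by rewrite /s mulrAC ler_pdivrMr // ler_wpM2l ?(ltW del0) // lerDl.
clearbody s.
have cross n : L (iterate p n * q * h ^+ 2) <= - del.
  rewrite opprK {2}(iterate_telescope p n) !mulrDl pairingD lerDr.
  rewrite !mulr_suml pairing_bigsum sumr_ge0 // => k _.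
  have -> : iterate p k ^+ 2 * q * h ^+ 2 = q * (iterate p k * h) ^+ 2 by ring.
  exact: q0.
have low n : s * del <= L (1 * (iterate p n * h) ^+ 2).
  have := one (iterate p n * h + s *: (q * h)).
  have -> : 1 * (iterate p n * h + s *: (q * h)) ^+ 2 =
      1 * (iterate p n * h) ^+ 2 + (2 * s) *: (iterate p n * q * h ^+ 2)
      + s ^+ 2 *: (1 * (q * h) ^+ 2).
    rewrite -!mul_mpolyC expr2 !mpolyCM mpolyC_nat.
    by ring.
  rewrite !pairingD !pairingZ -/C => pos.
  have := cross n; set b := L (_ * q * _) in pos * => bd.
  have sC2 : s ^+ 2 * C <= s * del.
    by rewrite expr2 -mulrA ler_wpM2l // ltW.
  have : s * b <= s * - del by rewrite ler_wpM2l // ltW.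
  move: pos sC2; set a := L _; clearbody a b C del => *; lra.
have eta0 : 0 < s * del by rewrite mulr_gt0.
pose B := L (p * h ^+ 2).
have sumB n : n%:R * (s * del) <= B.
  rewrite /B {1}(iterate_telescope p n) mulrDl pairingD.
  rewrite mulr_suml pairing_bigsum ler_wpDr //.
    exact: (op_nonneg_iterate n p0 p1).1.
  rewrite mulr_natl -[X in X <= _](_ : \sum_(k < n) s * del = _); last first.
    by rewrite sumr_const card_ord.
  apply: ler_sum => k _; apply: le_trans (low k) _.
  by rewrite le_eqVlt; apply/orP; left; apply/eqP; congr pairing; ring.
have := sumB (Num.bound (B / (s * del))).
have B0 : 0 <= B / (s * del) by rewrite divr_ge0 ?(ltW eta0) ?p0.
have /= := archi_boundP B0.
by rewrite ltr_pdivrMr // ltNge => /negP h1 /h1.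
Qed.

Lemma op_nonneg_word (I : finType) (Y : I -> mpoly m R) :
  \sum_i Y i = 1 -> (forall i, op_nonneg (Y i)) ->
  forall (J : Type) (r : seq J) (a : J -> I), op_nonneg (\prod_(j <- r) Y (a j)).
Proof.
move=> Y1 Y0 J r a; elim: r => [|j r IHr].
  by rewrite big_nil -Y1; apply: op_nonneg_sum.
rewrite big_cons; apply: op_nonnegM => //.
rewrite -Y1 (bigD1 (a j)) //= addrC addrK.
exact: op_nonneg_sum.
Qed.

End OpNonneg.

(** * A finite de Finetti theorem *)

(** Letters drawn independently with formal weights [Y] of sum 1: prescribing
    the letters at [D] distinct positions leaves the product of their weights. *)
Lemma sum_words_marginal (T : comPzRingType) (I : finType) (Y : I -> T)
    (N D : nat) (s : 'I_D -> 'I_N) (a : 'I_D -> I) :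
  \sum_i Y i = 1 -> injective s ->
  \sum_(v : {ffun 'I_N -> I}) (\prod_j Y (v j)) *+ [forall l, v (s l) == a l]
  = \prod_l Y (a l).
Proof.
move=> Y1 sI.
pose F j i := Y i *+ [forall l, (s l == j) ==> (i == a l)].
transitivity (\sum_(v : {ffun 'I_N -> I}) \prod_j F j (v j)).
  apply: eq_bigr => v _; rewrite /F prodrMn; congr (_ *+ _).
  case: forallP => [va|/forallP]; last first.
    rewrite negb_forall => /existsP[l /negPf vl].
    rewrite (bigD1 (s l)) //=; case: forallP => [/(_ l)|_];
      last by rewrite mul0n.
    by rewrite eqxx vl.
  rewrite big1 // => j _; case: forallP => // -[] l.
  by apply/implyP => /eqP <-; apply: va.
rewrite -bigA_distr_bigA (partition_big s xpredT) //=; apply: eq_bigr => j _.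
case: (pickP (fun l => s l == j)) => [l0 /eqP sl0|noj].
  rewrite (big_pred1 l0) => [|l]; last by rewrite -sl0 (inj_eq sI).
  rewrite (bigD1 (a l0)) //= big1 ?addr0 /F => [|i /negPf ia].
    case: forallP => [_|[]]; first by rewrite mulr1n.
    by move=> l; apply/implyP; rewrite -sl0 (inj_eq sI) => /eqP ->.
  case: forallP => [/(_ l0)|_]; last by rewrite mulr0n.
  by rewrite sl0 eqxx ia.
rewrite [RHS]big_pred0 // -Y1; apply: eq_bigr => i _; rewrite /F.
case: forallP => [_|[]]; first by rewrite mulr1n.
by move=> l; rewrite noj.
Qed.

(** All but a fraction [D^2 / N] of the maps from [D] to [N] points are
    injective. *)
Lemma ffact_lower_bound N D : ((N ^ D - N ^_ D) * N <= D ^ 2 * N ^ D)%N.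
Proof.
elim: D => [|D IHD]; first by rewrite expn0 ffactn0.
have le1 : (N ^_ D <= N ^ D)%N.
  elim: {IHD} D => [|D IHD]; first by rewrite ffactn0 expn0.
  by rewrite ffactnSr expnSr leq_mul // leq_subr.
rewrite ffactnSr expnSr; move: IHD le1; move: (N ^ D)%N (N ^_ D)%N => x y H1 H2.
have step : (x * N - y * (N - D) <= (x - y) * N + y * D)%N.
  by rewrite mulnBr mulnBl; lia.
have H3 : (y * D <= x * D)%N by rewrite leq_mul.
apply: leq_trans (_ : (D ^ 2 * x + x * D) * N <= _)%N.
  by rewrite leq_mul // (leq_trans step) // leq_add.
rewrite [X in (_ <= X)%N]mulnA leq_mul // expnS expn1; lia.
Qed.

Section DeFinetti.
Variables (R : realType) (m : nat) (w : multinom m -> R) (I : finType).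
Variable Y : I -> mpoly m R.
Hypotheses (Y1 : \sum_i Y i = 1) (Y0 : forall i, op_nonneg w (Y i)).
Local Notation L p := (pairing p w).

(** The probability (up to the factor [L 1]) of a random word whose law is
    exchangeable; [freq] is its vector of letter frequencies. *)
Definition word_weight N (v : {ffun 'I_N -> I}) : R := L (\prod_j Y (v j)).

Definition freq N (v : {ffun 'I_N -> I}) (i : I) : R :=
  (\sum_j (v j == i)%:R) / N%:R.

Lemma word_weight_ge0 N (v : {ffun 'I_N -> I}) : 0 <= word_weight v.
Proof. exact/op_nonneg_ge0/(op_nonneg_word Y1 Y0). Qed.

Lemma sum_word_weight N : \sum_(v : {ffun 'I_N -> I}) word_weight v = L 1.
Proof.
rewrite /word_weight -pairing_bigsum -(bigA_distr_bigA (fun _ i => Y i)).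
congr pairing.
by rewrite big1 // => j _; apply: Y1.
Qed.

Lemma freq_ge0 N (v : {ffun 'I_N -> I}) i : 0 <= freq v i.
Proof. by rewrite divr_ge0 // sumr_ge0. Qed.

Lemma sum_freq N (v : {ffun 'I_N -> I}) : (0 < N)%N -> \sum_i freq v i = 1.
Proof.
move=> N0; rewrite -mulr_suml exchange_big /=.
rewrite (eq_bigr (fun=> 1)) => [|j _]; last first.
  rewrite (bigD1 (v j)) //= eqxx big1 ?addr0 // => i.
  by rewrite eq_sym => /negPf ->.
by rewrite sumr_const card_ord divff // pnatr_eq0 -lt0n.
Qed.

(** Expanding the product of frequencies gives an average over all choices of
    [D] positions.  Each injective choice contributes exactly the value at the
    monomial ([sum_words_marginal]), and the other choices are rare. *)
Lemma word_weight_moments N D (a : 'I_D -> I) : (0 < N)%N ->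
  `| \sum_(v : {ffun 'I_N -> I}) word_weight v * \prod_l freq v (a l)
     - L (\prod_l Y (a l)) | <= (D ^ 2)%:R / N%:R * L 1.
Proof.
move=> N0; have N0R : 0 < N%:R :> R by rewrite ltr0n.
pose c (s : {ffun 'I_D -> 'I_N}) : R :=
  \sum_(v : {ffun 'I_N -> I}) word_weight v * [forall l, v (s l) == a l]%:R.
have sumc : \sum_(v : {ffun 'I_N -> I}) word_weight v * \prod_l freq v (a l)
    = (N ^ D)%:R^-1 * \sum_s c s.
  rewrite /c exchange_big mulr_sumr; apply: eq_bigr => v _ /=.
  rewrite /freq prodf_div -mulr_sumr prodr_const card_ord natrX.
  rewrite [RHS]mulrC -mulrA; congr (_ * (_ * _)).
  rewrite bigA_distr_bigA; apply: eq_bigr => s _.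
  rewrite -natr_prod; congr (_%:R).
  case: forallP => [va|/forallP]; last first.
    rewrite negb_forall => /existsP[l /negPf vl].
    by rewrite (bigD1 l) //= vl mul0n.
  by rewrite big1 // => l _; rewrite va.
have L10 : 0 <= L 1.
  by rewrite -(sum_word_weight 0) sumr_ge0 // => v _; exact: word_weight_ge0.
have LY : 0 <= L (\prod_l Y (a l)) <= L 1.
  have -> : \prod_l Y (a l) = \prod_l Y ([ffun l => a l] l).
    by apply: eq_bigr => l _; rewrite ffunE.
  rewrite -[L _]/(word_weight _) word_weight_ge0 /= -(sum_word_weight D).
  rewrite (bigD1 [ffun l => a l]) //= lerDl sumr_ge0 // => v _.
  exact: word_weight_ge0.
have c01 s : 0 <= c s <= L 1.
  rewrite sumr_ge0 /= => [|v _]; last by rewrite mulr_ge0 // word_weight_ge0.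
  rewrite -(sum_word_weight N) ler_sum // => v _.
  by case: forallP => _; rewrite ?mulr1 ?mulr0 // word_weight_ge0.
have cinj (s : {ffun 'I_D -> 'I_N}) : injectiveb s -> c s = L (\prod_l Y (a l)).
  move=> /injectiveP sI; rewrite -(sum_words_marginal a Y1 sI) pairing_bigsum.
  apply: eq_bigr => v _.
  by case: forallP => _; rewrite ?mulr1 ?mulr0 ?mulr1n ?mulr0n ?pairing0.
have -> : L (\prod_l Y (a l)) =
    (N ^ D)%:R^-1 * \sum_(s : {ffun 'I_D -> 'I_N}) L (\prod_l Y (a l)).
  rewrite sumr_const card_ffun !card_ord -(mulr_natl (L _)) mulKf //.
  by rewrite pnatr_eq0 -lt0n expn_gt0 N0.
have ND0 : 0 < (N ^ D)%:R :> R by rewrite ltr0n expn_gt0 N0.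
rewrite sumc -mulrBr normrM ger0_norm ?invr_ge0 ?ler0n // ler_pdivrMl //.
rewrite -sumrB (bigID (fun s : {ffun 'I_D -> 'I_N} => injectiveb s)) /=.
rewrite big1 ?add0r => [|s /cinj ->]; last by rewrite subrr.
apply: le_trans (ler_norm_sum _ _ _) _.
apply: le_trans (_ : \sum_(s : {ffun 'I_D -> 'I_N} | ~~ injectiveb s) L 1 <= _).
  apply: ler_sum => s _; rewrite ler_norml.
  have /andP[c0 c1] := c01 s; have /andP[l0 l1] := LY.
  by apply/andP; split; lra.
rewrite sumr_const -(mulr_natl (L 1)) mulrA ler_wpM2r // mulrA ler_pdivlMr //.
rewrite -!natrM ler_nat [X in (_ <= X)%N]mulnC.
apply: leq_trans (ffact_lower_bound N D); rewrite leq_mul //.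
have := cardC (mem [set f : {ffun 'I_D -> 'I_N} | injectiveb f]%SET).
rewrite card_inj_ffuns card_ffun !card_ord => <-; rewrite addKn.
by apply/eq_leq/eq_card => s; rewrite !inE.
Qed.

End DeFinetti.

(** * Ultralimits and closedness of the completely positive cone *)

Lemma free_ultrafilter : exists U : set_system nat, UltraFilter U /\ \oo `<=` U.
Proof. exact: ultraFilterLemma. Qed.

Section Ultralimits.
Variables (R : realType) (U : set_system nat).
Context {UU : UltraFilter U}.

Lemma ultra_cvg (u : nat -> R) (c : R) :
  (\forall k \near U, `|u k| <= c) -> exists l : R, u @ U --> l.
Proof.
move=> uc; have Uc : (u @ U) `[- c, c]%classic.
  by apply: filterS uc => k /=; rewrite in_itv /= ler_norml.
have [l [_ ucl]] := segment_compact _ Uc.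
exists l => V lV; have [//|UV] := in_ultra_setVsetC (u @^-1` V) UU.
by have [x []] := ucl (~` V) V UV lV.
Qed.

Lemma cvg_bigsum (I : Type) (r : seq I) (P : pred I)
    (u : I -> nat -> R) (l : I -> R) :
  (forall i, P i -> u i @ U --> l i) ->
  (fun k => \sum_(i <- r | P i) u i k) @ U --> \sum_(i <- r | P i) l i.
Proof. by apply: cvg_big; exact: add_continuous. Qed.

Lemma cvg_bigprod (I : Type) (r : seq I) (P : pred I)
    (u : I -> nat -> R) (l : I -> R) :
  (forall i, P i -> u i @ U --> l i) ->
  (fun k => \prod_(i <- r | P i) u i k) @ U --> \prod_(i <- r | P i) l i.
Proof. by apply: cvg_big; exact: mul_continuous. Qed.

End Ultralimits.

(** Turns an accumulation point of a sequence into a limit along an ultrafilter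
    of indices, so that limits of further sequences exist along it. *)
Lemma cluster_ultrafilter (T : topologicalType) (f : nat -> T) x :
  cluster (f @ \oo) x -> exists U : set_system nat,
    [/\ UltraFilter U, \oo `<=` U & f @ U --> x].
Proof.
move=> clx.
pose H : set_system nat := [set E | exists2 V, nbhs x V &
  \forall k \near \oo, V (f k) -> E k].
have HF : ProperFilter H.
  apply: Build_ProperFilter => [|].
    move=> [V xV [K _ VE]].
    have [|y [[k /= Kk <-] Vk]] := clx (f @` [set k | (K <= k)%N]) V _ xV.
      by exists K => // k Kk; exists k.
    exact: VE Kk Vk.
  split.
  - by exists setT; [exact: filterT|exact: filterE].
  - move=> E E' [V xV VE] [V' xV' VE']; exists (V `&` V'); first exact: filterI.
    by apply: filterS2 VE VE' => k h h' [/h ? /h' ?].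
  - move=> E E' EE' [V xV VE]; exists V => //.
    by apply: filterS VE => k h /h /EE'.
have [U [UU HU]] := ultraFilterLemma HF.
exists U; split=> // [E oE|V xV]; apply: HU.
  by exists setT; [exact: filterT|apply: filterS oE => k].
by exists V => //; apply: filterE.
Qed.

Lemma near_harmonic (R : realType) (C eps : R) : 0 < eps ->
  \forall k \near \oo, C / k.+1%:R <= eps.
Proof.
move=> e0; exists (Num.bound (`|C| / eps)) => // k /= Ck.
rewrite ler_pdivrMr ?ltr0Sn // -ler_pdivrMl // mulrC.
apply: le_trans (_ : `|C| / eps <= _).
  by rewrite ler_wpM2r ?invr_ge0 ?(ltW e0) ?ler_norm.
have /ltW/le_trans := archi_boundP (divr_ge0 (normr_ge0 C) (ltW e0)).
by apply; rewrite ler_nat (leq_trans Ck).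
Qed.

Section CompletelyPositive.
Variables (R : realType) (d n : nat).
Hypothesis hd : (0 < d)%N.
Implicit Types (A : tensor R d n) (v : 'rV[R]_n).

Lemma tensor_powZ c v : tensor_pow d (c *: v) = c ^+ d *: tensor_pow d v.
Proof.
apply/ffunP => t; rewrite !ffunE.
under eq_bigr do rewrite mxE.
by rewrite big_split /= prodr_const card_ord.
Qed.

Lemma tensor_pow0 : tensor_pow d (0 : 'rV[R]_n) = 0.
Proof. by rewrite -(scale0r 0) tensor_powZ expr0n gtn_eqF // scale0r. Qed.

Lemma choose_roots (I : Type) (c : I -> R) : (forall i, 0 <= c i) ->
  exists2 s : I -> R, forall i, 0 <= s i & forall i, s i ^+ d = c i.
Proof.
move=> c0; exists (fun i => c i `^ d%:R^-1) => i; first exact: powR_ge0.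
by rewrite -powR_mulrn ?powR_ge0 // -powRrM mulVf ?powRr1 // pnatr_eq0 -lt0n.
Qed.

Lemma completely_positive_combination A (I : finType) (c : I -> R)
    (u : I -> 'rV[R]_n) :
  (forall j, 0 <= c j) -> (forall j i, 0 <= u j 0 i) ->
  A = \sum_j c j *: tensor_pow d (u j) -> completely_positive A.
Proof.
move=> c0 u0 ->; have [s s0 sd] := choose_roots c0.
exists #|I|, (fun j => s (enum_val j) *: u (enum_val j)); split.
  by move=> j i; rewrite mxE mulr_ge0.
rewrite (reindex _ (onW_bij _ (enum_val_bij _))) /=; apply: eq_bigr => j _.
by rewrite tensor_powZ sd.
Qed.

Local Notation D := #|{: d.-tuple 'I_n}|.

(** Moving along a linear relation between the powers until the first
    coefficient vanishes removes one summand. *)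
Lemma caratheodory_step r (v : 'I_r.+1 -> 'rV[R]_n) :
  (D < r.+1)%N -> (forall j i, 0 <= v j 0 i) ->
  exists2 v' : 'I_r -> 'rV[R]_n, forall j i, 0 <= v' j 0 i &
    \sum_j tensor_pow d (v j) = \sum_j tensor_pow d (v' j).
Proof.
move=> Dr v0.
pose M : 'M[R]_(r.+1, D) := \matrix_(j, t) tensor_pow d (v j) (enum_val t).
have : kermx M != 0.
  by rewrite kermx_eq0 -row_leq_rank -ltnNge (leq_ltn_trans (rank_leq_col M)).
move=> /rowV0Pn[l0 /sub_kermxP l0M l0N0].
have [l lM [j lj]] : exists2 l : 'rV[R]_r.+1, l *m M = 0 & exists j, 0 < l 0 j.
  have /rV0Pn[j lj] := l0N0; case: (ltgtP (l0 0 j) 0) lj => // lj _.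
    by exists (- l0); [rewrite mulNmx l0M oppr0|exists j; rewrite mxE oppr_gt0].
  by exists l0 => //; exists j.
pose j0 := [arg max_(i > j) l 0 i]%O.
have lmax i : l 0 i <= l 0 j0.
  by rewrite /j0; case: arg_maxP => // k _ kmax; apply: kmax.
have l00 : 0 < l 0 j0 by apply: lt_le_trans (lmax j).
(* The largest step along the relation that keeps all coefficients nonnegative. *)
pose c i := 1 - l 0 i / l 0 j0.
have c0 i : 0 <= c i by rewrite subr_ge0 ler_pdivrMr // mul1r.
have [s s0 sd] := choose_roots c0.
exists (fun i => s (lift j0 i) *: v (lift j0 i)).
  by move=> k i; rewrite mxE mulr_ge0.
transitivity (\sum_i c i *: tensor_pow d (v i)); last first.
  rewrite (bigD1_ord j0) //= /c divff ?gt_eqF // subrr scale0r add0r.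
  by apply: eq_bigr => i _; rewrite tensor_powZ sd.
rewrite /c; under [RHS]eq_bigr do rewrite scalerBl scale1r.
rewrite sumrB [X in _ = _ - X](_ : _ = 0) ?subr0 //.
apply/ffunP => t; rewrite sum_ffunE [RHS]ffunE.
have := congr1 (fun B : 'rV[R]_D => B 0 (enum_rank t)) lM; rewrite !mxE.
move=> /(congr1 (fun x => (l 0 j0)^-1 * x)); rewrite mulr0 => {2}<-.
rewrite mulr_sumr; apply: eq_bigr => i _.
by rewrite !mxE enum_rankK !ffunE mulrA; congr (_ * _); rewrite mulrC.
Qed.

(** A number of summands that depends on [d] and [n] only is what makes a
    sequence of decompositions compact. *)
Lemma caratheodory A : completely_positive A ->
  exists2 v : 'I_D -> 'rV[R]_n, forall j i, 0 <= v j 0 i &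
    A = \sum_j tensor_pow d (v j).
Proof.
case=> r [v [v0 ->]]; have [k] := ubnP r; elim: k r v v0 => // k IHk r v v0 rk.
have [rD|] := leqP r D.
  exists (fun j => if insub (val j) is Some i then v i else 0).
    by move=> j i; case: insubP => [*|_]; rewrite ?mxE.
  pose F j := if insub j is Some i then tensor_pow d (v i) else 0.
  transitivity (\sum_(j < r) F j).
    by apply: eq_bigr => j _; rewrite /F insubT // => lt_j;
      congr (tensor_pow d (v _)); apply: val_inj.
  rewrite (big_ord_widen D F rD) big_mkcond; apply: eq_bigr => j _.
  rewrite /F; case: insubP => [i -> _|/negPf ->]; last by rewrite tensor_pow0.
  by [].
case: r v v0 rk => // r v v0 rk /caratheodory_step /(_ v0)[v' v'0 ->].
exact: IHk.
Qed.

(** The [d]-th power of [v j 0 i] is one of the nonnegative summands of a diagonal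
    entry of [A]. *)
Lemma tensor_entry_bound A (I : finType) (v : I -> 'rV[R]_n) j i t :
  (forall j i, 0 <= v j 0 i) -> A = \sum_j tensor_pow d (v j) ->
  t = nseq_tuple d i -> v j 0 i <= 1 + `|A t|.
Proof.
move=> v0 -> ->; have [v1|v1] := leP (v j 0 i) 1.
  by rewrite (le_trans v1) // lerDl.
apply: le_trans (_ : v j 0 i ^+ d <= _); first by rewrite ler_eXnr // ltW.
rewrite sum_ffunE (bigD1 j) //= -[X in X <= _]add0r lerD //.
apply: le_trans (ler_norm _); rewrite ffunE.
rewrite [X in _ <= X + _](eq_bigr (fun=> v j 0 i)) => [|k _]; last first.
  by rewrite (tnth_nth i) nth_nseq ltn_ord.
rewrite prodr_const card_ord lerDl sumr_ge0 // => k _.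
by rewrite ffunE prodr_ge0.
Qed.

Lemma completely_positive_closed A :
  (forall eps, 0 < eps -> exists2 B, completely_positive B &
     forall t, `|B t - A t| <= eps) -> completely_positive A.
Proof.
move=> Acl.
have /choice[v hv] k : exists v : 'I_D -> 'rV[R]_n,
    (forall j i, 0 <= v j 0 i) /\
    forall t, `|(\sum_j tensor_pow d (v j)) t - A t| <= 1 / k.+1%:R.
  have [|B /caratheodory[v v0 ->] BA] := Acl (1 / k.+1%:R).
    by rewrite divr_gt0 // ltr0Sn.
  by exists v.
have [U [UU oU]] := free_ultrafilter.
have /choice[l hl] (ji : 'I_D * 'I_n) :
    exists l : R, (fun k => v k ji.1 0 ji.2) @ U --> l.
  case: ji => j i /=; pose t := nseq_tuple d i.
  apply: (@ultra_cvg _ _ _ _ (2 + `|A t|)); apply: filterE => k.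
  have [v0 vA] := hv k; rewrite ger0_norm //.
  apply: le_trans (tensor_entry_bound j v0 erefl (erefl t)) _.
  have /le_trans/(_ (_ : _ <= 1)) := vA t; rewrite ler_pdivrMr ?ltr0Sn //.
  rewrite mul1r ler1n => /(_ isT) h.
  have := ler_normD (A t) ((\sum_j tensor_pow d (v k j)) t - A t).
  rewrite addrCA subrr addr0; lra.
exists D, (fun j => \row_i l (j, i)); split.
  move=> j i; rewrite mxE; apply: cvgr_to_ge (hl (j, i)) _.
  by apply: filterE => k; have [] := hv k.
apply/ffunP => t; rewrite sum_ffunE.
apply: (@cvg_unique _ _ ((fun k => (\sum_j tensor_pow d (v k j)) t) @ U)) => /=.
  exact: norm_hausdorff.
  apply/cvgrPdist_le => eps e0; apply: oU.
  apply: filterS (near_harmonic 1 e0) => k.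
  by move=> /(le_trans ((hv k).2 t)); rewrite distrC.
under eq_fun do rewrite sum_ffunE.
apply: cvg_bigsum => j _; under eq_fun do rewrite ffunE.
rewrite ffunE; apply: cvg_bigprod => i _; rewrite mxE; exact: (hl (j, _)).
Qed.

End CompletelyPositive.

(** * Functionals on the simplex *)

Lemma exists_word m (a : multinom m) : exists2 s : seq 'I_m, size s = mdeg a &
  forall (T : comPzRingType) (g : 'I_m -> T),
    \prod_(i <- s) g i = \prod_i g i ^+ a i.
Proof.
exists (flatten [seq nseq (a i) i | i <- enum 'I_m]).
  rewrite size_flatten sumnE /shape -map_comp big_map big_enum mdegE.
  by apply: eq_bigr => i _; rewrite /= size_nseq.
move=> T g; rewrite big_flatten big_map big_enum /=; apply: eq_bigr => i _.
by rewrite big_nseq iter_mulr_1.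
Qed.

Lemma ge0_harmonic (R : realType) (x C : R) :
  (forall N, - (C / N.+1%:R) <= x) -> 0 <= x.
Proof.
move=> xC; rewrite leNgt; apply/negP => x0.
have e0 : 0 < - x / 2 by rewrite divr_gt0 // oppr_gt0.
have [N _ /(_ N (leqnn N))] := near_harmonic C e0.
move=> /= cN; have := le_trans (xC N) (lexx _); move: cN; set c := C / _; lra.
Qed.

Section Simplex.
Variables (R : realType) (m : nat).

Definition in_simplex (u : 'I_m -> R) := (forall i, 0 <= u i) /\ \sum_i u i <= 1.

Definition barycentric (i : 'I_m.+1) : mpoly m R :=
  if unlift ord_max i is Some j then var j else 1 - \sum_(j < m) var j.

Lemma barycentric_lift j : barycentric (lift ord_max j) = var j.
Proof. by rewrite /barycentric liftK. Qed.

Lemma barycentric_max : barycentric ord_max = 1 - \sum_(j < m) var j.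
Proof. by rewrite /barycentric unlift_none. Qed.

Lemma sum_barycentric : \sum_i barycentric i = 1.
Proof.
rewrite (bigD1_ord ord_max) //= barycentric_max.
by under eq_bigr do rewrite barycentric_lift; rewrite subrK.
Qed.

Lemma pairingX (w : multinom m -> R) a : pairing (mpolyX R a) w = w a.
Proof. by rewrite /pairing msuppX big_seq1 mcoeffX eqxx mul1r. Qed.

(** By the Riesz-Haviland theorem these are the moment sequences of the measures
    on the simplex. *)
Definition simplex_nonneg (w : multinom m -> R) :=
  forall f, (forall u, in_simplex u -> 0 <= meval u f) -> 0 <= pairing f w.

Section QuadraticModule.
Variable w : multinom m -> R.
Hypotheses (wvar : forall i, op_nonneg w (var i))
  (wslack : op_nonneg w (1 - \sum_(i < m) var i)).

Lemma op_nonneg_barycentric i : op_nonneg w (barycentric i).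
Proof.
by case: (unliftP ord_max i) => [j|] ->;
  rewrite ?barycentric_lift ?barycentric_max.
Qed.

Let weight N (v : {ffun 'I_N -> 'I_m.+1}) := word_weight w barycentric v.
Let point N (v : {ffun 'I_N -> 'I_m.+1}) (j : 'I_m) : R :=
  freq R v (lift ord_max j).

Lemma freq_in_simplex N (v : {ffun 'I_N.+1 -> 'I_m.+1}) : in_simplex (point v).
Proof.
split=> [i|]; first exact: freq_ge0.
rewrite -(sum_freq R v) // (bigD1_ord ord_max) //= lerDr; exact: freq_ge0.
Qed.

(** The letter frequencies of the random words of length [N + 1] are nodes of a
    quadrature formula for [w] with nonnegative weights and error [O(1/N)]. *)
Lemma quadrature (f : mpoly m R) : exists C, forall N,
  `|\sum_(v : {ffun 'I_N.+1 -> 'I_m.+1}) weight v * meval (point v) f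
    - pairing f w| <= C / N.+1%:R.
Proof.
pose C (a : multinom m) : R := (mdeg a ^ 2)%:R * pairing 1 w.
have mono (a : multinom m) N : `|\sum_(v : {ffun 'I_N.+1 -> 'I_m.+1})
    weight v * \prod_i point v i ^+ a i - w a| <= C a / N.+1%:R.
  have [s sa sE] := exists_word a.
  have := @word_weight_moments R m w _ barycentric sum_barycentric
    op_nonneg_barycentric N.+1 _
    (fun l => lift ord_max (tnth (in_tuple s) l)) isT.
  rewrite /C -sa mulrAC; congr (is_true (`|_ - _| <= _)).
    apply: eq_bigr => v _; congr (_ * _); rewrite -sE.
    by rewrite [RHS]big_tnth; apply: eq_bigr.
  rewrite -[RHS]pairingX mpolyXE_id -(sE _ (fun i => var i)).
  rewrite [in RHS]big_tnth; congr pairing; apply: eq_bigr => l _.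
  exact: barycentric_lift.
exists (\sum_(a <- msupp f) `|mcoeff a f| * C a) => N.
have -> : \sum_(v : {ffun 'I_N.+1 -> 'I_m.+1}) weight v * meval (point v) f
    = \sum_(a <- msupp f) mcoeff a f *
      \sum_(v : {ffun 'I_N.+1 -> 'I_m.+1}) weight v * \prod_i point v i ^+ a i.
  under [RHS]eq_bigr do rewrite mulr_sumr.
  rewrite exchange_big; apply: eq_bigr => v _; rewrite mevalE mulr_sumr.
  by apply: eq_bigr => a _; rewrite mulrCA.
rewrite /pairing -sumrB mulr_suml; apply: le_trans (ler_norm_sum _ _ _) _.
by apply: ler_sum => a _; rewrite -mulrBr normrM -mulrA ler_wpM2l.
Qed.

(** The quadrature formula writes [pairing f w] as a limit of nonnegative
    combinations of values of [f] on the simplex. *)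
Lemma simplex_positivity : simplex_nonneg w.
Proof.
move=> f f0; have [C hC] := quadrature f.
apply: (@ge0_harmonic _ _ C) => N; have := hC N.
set S := \sum_v _; have : 0 <= S.
  apply: sumr_ge0 => v _; rewrite mulr_ge0 ?f0 //; last exact: freq_in_simplex.
  exact: (word_weight_ge0 sum_barycentric op_nonneg_barycentric).
rewrite ler_norml => S0 /andP[_]; set c := C / _; clearbody S c; lra.
Qed.

(** The quadrature formula turns [A] into a limit of nonnegative combinations of
    the [d]-th powers of the frequency vectors. *)
Lemma completely_positive_of_functional d (A : tensor R d m.+1) : (0 < d)%N ->
  (forall t, A t = pairing (\prod_(i <- t) barycentric i) w) ->
  completely_positive A.
Proof.
move=> d0 At; apply: completely_positive_closed => // eps e0.
have [N _ /(_ N (leqnn N)) eN] := near_harmonic ((d ^ 2)%:R * pairing 1 w) e0.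
exists (\sum_(v : {ffun 'I_N.+1 -> 'I_m.+1})
    weight v *: tensor_pow d (\row_i freq R v i)).
  apply: (completely_positive_combination d0) (erefl _) => [v|v i].
    exact: (word_weight_ge0 sum_barycentric op_nonneg_barycentric).
  by rewrite mxE freq_ge0.
move=> t; apply: le_trans eN.
have := @word_weight_moments R m w _ barycentric sum_barycentric
    op_nonneg_barycentric N.+1 _ (fun l => tnth t l) isT.
rewrite mulrAC At big_tuple; congr (is_true (`|_ - _| <= _)).
rewrite sum_ffunE; apply: eq_bigr => v _; rewrite !ffunE; congr (_ * _).
by apply: eq_bigr => l _; rewrite mxE.
Qed.

End QuadraticModule.
End Simplex.

Section MomentCondition.
Variables (R : realType) (d m : nat).
Implicit Types (A : tensor R d m.+1).

Local Notation bar a := (@bar_monomial R m.+1 a).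

Definition moment_cond A (w : multinom m -> R) :=
  forall a : multinom m, (mdeg a <= d)%N ->
    w a = pairing (bar a * (\sum_(i < m.+1) var i) ^+ (d - mdeg a))
                  (phi A).

Lemma lift_max_widen (j : 'I_m) :
  widen_ord (leq_pred m.+1) j = lift ord_max j.
Proof. by apply: val_inj; rewrite [RHS]lift_max. Qed.

Lemma bar_monomialE (a : multinom m) :
  bar a = \prod_(i < m) var (lift ord_max i) ^+ a i :> mpoly m.+1 R.
Proof. by apply: eq_bigr => i _; rewrite lift_max_widen. Qed.

Lemma bar_monomialS (a : multinom m) j :
  bar (mnm_add a (mnm1 j)) = bar a * var (lift ord_max j)
    :> mpoly m.+1 R.
Proof.
rewrite !bar_monomialE; under eq_bigr do rewrite mnmDE mnm1E exprD.
rewrite big_split /=; congr (_ * _); rewrite (bigD1 j) //= eqxx big1 ?mulr1 //.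
by move=> i; rewrite eq_sym => /negPf ->.
Qed.

Lemma pairing_phi_word A (t : d.-tuple 'I_m.+1) : symmetric_tensor A ->
  pairing (\prod_(i <- t) var i) (phi A) = A t.
Proof.
move=> symA; rewrite prod_varE pairingX.
by apply: phiE => //; rewrite prod_varE.
Qed.

(** The equality constraints fix [w] on [x_bar^a (e^T x)^(d - |a|)] with
    [e^T x] set to 1.  The last variable is [e^T x] minus the others, so by
    induction the constraints extend to all words of degree [d], with the last
    variable replaced by [1 - e^T x_bar]. *)
Lemma moment_cond_word A w s (a : multinom m) e :
  moment_cond A w -> (mdeg a + size s + e = d)%N ->
  pairing (bar a * \prod_(i <- s) var i * (\sum_(i < m.+1) var i) ^+ e)
          (phi A)
  = pairing (mpolyX R a * \prod_(i <- s) barycentric R i) w.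
Proof.
move=> Aw; elim: s a e => [|i s IHs] a e ade.
  rewrite !big_nil !mulr1 pairingX Aw; last by lia.
  by congr (pairing (_ * _ ^+ _) _); move: ade => /=; lia.
have addU j : pairing (bar a * (var (lift ord_max j) *
      \prod_(i <- s) var i) * (\sum_(i < m.+1) var i) ^+ e) (phi A)
    = pairing (mpolyX R a * (var j * \prod_(i <- s) barycentric R i)) w.
  have := IHs (mnm_add a (mnm1 j)) e.
  rewrite bar_monomialS mpolyXD -!mulrA; apply.
  by move: ade; rewrite mdegD mdeg1 /=; lia.
rewrite !big_cons; case: (unliftP ord_max i) => [j|] ->.
  by rewrite barycentric_lift; apply: addU.
rewrite barycentric_max mulrBl mul1r mulrBr pairingB mulr_suml mulr_sumr.
have -> : var ord_max = \sum_(i < m.+1) var i - \sum_j var (lift ord_max j)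
    :> mpoly m.+1 R.
  by rewrite [in X in _ = X - _](bigD1_ord ord_max) //= addrK.
rewrite mulrBl mulrBr mulrBl pairingB; congr (_ - _).
  rewrite -(IHs a e.+1); last by move: ade => /=; lia.
  by congr pairing; rewrite exprS; ring.
rewrite mulr_suml mulr_sumr mulr_suml !pairing_bigsum.
by apply: eq_bigr => j _; apply: addU.
Qed.

Lemma moment_cond_tensor A w : symmetric_tensor A -> moment_cond A w ->
  forall t, A t = pairing (\prod_(i <- t) barycentric R i) w.
Proof.
move=> symA Aw t; rewrite -pairing_phi_word //.
have := @moment_cond_word A w t mnm0 0 Aw.
rewrite mdeg0 size_tuple add0n addn0 => /(_ erefl).
rewrite expr0 mulr1 mpolyX0 mul1r => <-; congr pairing.
rewrite /bar_monomial [X in _ = X * _]big1 ?mul1r // => i _.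
by rewrite mnm0E expr0.
Qed.

Lemma pairing_phi_sum A (I : finType) (v : I -> 'rV[R]_m.+1)
    (s : seq 'I_m.+1) e :
  symmetric_tensor A -> A = \sum_j tensor_pow d (v j) -> (size s + e = d)%N ->
  pairing (\prod_(i <- s) var i * (\sum_(i < m.+1) var i) ^+ e) (phi A)
  = \sum_j (\prod_(i <- s) v j 0 i) * (\sum_i v j 0 i) ^+ e.
Proof.
move=> symA Av; elim: e s => [|e IHe] s se.
  have sd : size s == d by rewrite -se addn0.
  rewrite expr0 mulr1 (pairing_phi_word (Tuple sd)) // Av sum_ffunE.
  apply: eq_bigr => j _; rewrite ffunE expr0 mulr1.
  by rewrite [in RHS](big_tuple _ _ (Tuple sd)).
rewrite exprS mulr_suml mulr_sumr pairing_bigsum.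
under [RHS]eq_bigr do rewrite exprS mulr_suml mulr_sumr.
rewrite exchange_big; apply: eq_bigr => i _ /=.
have := IHe (i :: s).
rewrite big_cons mulrA [_ * var i]mulrC /= => -> //; last by lia.
by apply: eq_bigr => j _; rewrite big_cons mulrA [_ * v j 0 i]mulrC.
Qed.

(** Rescale each vector of a decomposition into the simplex: [v = s u] with
    [s = e^T v], and let [w] be the combination with weights [s^d] of the
    evaluations at the points [u_bar]. *)
Lemma completely_positive_functional A : (0 < d)%N -> symmetric_tensor A ->
  completely_positive A -> exists2 w, moment_cond A w & simplex_nonneg w.
Proof.
move=> d0 symA [r [v [v0 Av]]].
pose s j := \sum_i v j 0 i.
have s0 j : 0 <= s j by rewrite sumr_ge0.
pose u j i := v j 0 (lift ord_max i) / s j.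
pose w (a : multinom m) := \sum_j s j ^+ d * \prod_i u j i ^+ a i.
have us j : in_simplex (u j).
  split=> [i|]; first by rewrite divr_ge0.
  rewrite -mulr_suml; case: (eqVneq (s j) 0) => [->|sN0].
    by rewrite invr0 mulr0.
  rewrite ler_pdivrMr ?mul1r; last by rewrite lt_neqAle eq_sym sN0 s0.
  by rewrite /s (bigD1_ord ord_max) //= lerDr.
exists w => [a ad|f f0].
  have [t ta tE] := exists_word a.
  rewrite bar_monomialE -(tE _ (fun i => var (lift ord_max i))).
  rewrite -(big_map (lift ord_max) xpredT (fun i => var i)).
  rewrite (pairing_phi_sum symA Av); last by rewrite size_map ta subnKC.
  apply: eq_bigr => j _; rewrite big_map (tE _ (fun i => v j 0 (lift ord_max i))).
  rewrite -/(s j) /u; under eq_bigr do rewrite expr_div_n.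
  rewrite prodf_div prodrXr -mdegE.
  (* A zero vector has s = 0, and u is then the junk value 0. *)
  case: (eqVneq (s j) 0) => [sj0|sN0]; last first.
    by rewrite mulrCA -expfB_cond ?(negPf sN0).
  have vj0 i : v j 0 i = 0.
    by apply/eqP; move: sj0 => /psumr_eq0P -> //.
  rewrite sj0 expr0n gtn_eqF // mul0r; case: (posnP (mdeg a)) => [a0|a0].
    by rewrite a0 subn0 expr0n gtn_eqF // mulr0.
  move: a0; rewrite mdegE lt0n sum_nat_eq0 negb_forall => /existsP[i /= ai].
  by rewrite (bigD1 i) //= vj0 expr0n (negPf ai) !mul0r.
have -> : pairing f w = \sum_j s j ^+ d * meval (u j) f.
  rewrite /pairing; under eq_bigr do rewrite mulr_sumr.
  rewrite exchange_big; apply: eq_bigr => j _; rewrite mevalE mulr_sumr.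
  by apply: eq_bigr => a _; rewrite mulrCA.
by rewrite sumr_ge0 // => j _; rewrite mulr_ge0 ?exprn_ge0 ?f0.
Qed.

End MomentCondition.

(** * Null sets and uniqueness of minimizers of generic linear objectives *)

Definition dot (R : realType) N (c w : 'rV[R]_N) : R := \sum_i c 0 i * w 0 i.

Definition minimizes (R : realType) N (K : set 'rV[R]_N) (c w : 'rV[R]_N) :=
  K w /\ forall v, K v -> dot c w <= dot c v.

Section NullSets.
Variables (R : realType) (N : nat).
Local Notation V := 'rV[R]_N.+1.

Definition box (b : V * V) : set V :=
  [set v | forall i, b.1 0 i <= v 0 i <= b.2 0 i].
Definition volume (b : V * V) : R := \prod_i (b.2 0 i - b.1 0 i).
Definition ordered_box (b : V * V) := forall i, b.1 0 i <= b.2 0 i.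

Lemma volume_ge0 b : ordered_box b -> 0 <= volume b.
Proof. by move=> bo; rewrite prodr_ge0 // => i _; rewrite subr_ge0. Qed.

Lemma volume0 : volume (0, 0) = 0.
Proof. by rewrite /volume big_ord_recl !mxE subrr mul0r. Qed.

(** The finite list of boxes is padded by the box [(0, 0)]; its volume vanishes
    because the dimension [N.+1] is positive. *)
Lemma lebesgue_null_finite_covers (S : set V) :
  (forall eps, 0 < eps -> exists s : seq (V * V),
     [/\ forall b, b \in s -> ordered_box b,
         S `<=` [set v | exists2 b, b \in s & box b v] &
         \sum_(b <- s) volume b <= eps]) -> lebesgue_null S.
Proof.
move=> Scov eps /Scov[s [so Ss se]].
pose b j := nth (0, 0) s j.
have bo j : ordered_box (b j).
  have [js|js] := ltnP j (size s); first by apply: so; rewrite mem_nth.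
  by rewrite /b nth_default // => i.
exists (fun j => (b j).1), (fun j => (b j).2); split => //.
  move=> v /Ss[c cs cv]; exists (index c s) => //.
  by rewrite /= /b nth_index.
apply: lime_le => /=.
  by apply: is_cvg_nneseries => j _ _; rewrite lee_fin -/(volume _) volume_ge0.
apply: nearW => n; rewrite sumEFin lee_fin; apply: le_trans se.
rewrite -/(volume _) (eq_bigr (fun j => volume (b j))) // /b.
have vs c : c \in s -> 0 <= volume c by move=> /so/volume_ge0.
elim: s vs n {b bo so Ss} => [|c s IHs] vs n.
  by rewrite big_nil big1 // => j _; rewrite nth_nil volume0.
case: n => [|n].
  by rewrite big_nil big_seq sumr_ge0.
rewrite big_nat_recl //= big_cons lerD2l; apply: IHs => x xs.
by rewrite vs // inE xs orbT.
Qed.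

Lemma lebesgue_null_bigcup (S : nat -> set V) :
  (forall k, lebesgue_null (S k)) -> lebesgue_null (\bigcup_k S k).
Proof.
move=> S0 eps e0.
have ek k : 0 < eps / (2 ^ k.+1)%:R by rewrite divr_gt0 // ltr0n expn_gt0.
have /choice[l /choice[u lu]] := fun k => S0 k _ (ek k).
have /card_set_bijP[f fbij] : ([set: nat] #= [set: nat * nat])%card.
  by rewrite card_eq_sym; exact: card_nat2.
have v0 k j : (0 <= (\prod_i (u k j 0 i - l k j 0 i))%:E :> \bar R)%E.
  by rewrite lee_fin prodr_ge0 // => i _; rewrite subr_ge0; have [] := lu k.
exists (fun j => l (f j).1 (f j).2), (fun j => u (f j).1 (f j).2); split.
- by move=> j i; have [] := lu (f j).1.
- move=> v [k _ Skv]; have [_ /(_ _ Skv) [j _ vj] _] := lu k.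
  have [_ _ /(_ (k, j) I)[i _ fi]] := fbij.
  by exists i => //; rewrite fi.
rewrite nneseries_esumT //.
rewrite -(@reindex_esum _ _ _ _ _ f (fun kj : nat * nat =>
   (\prod_i (u kj.1 kj.2 0 i - l kj.1 kj.2 0 i))%:E) fbij).
rewrite (_ : [set: nat * nat] = [set: nat] `*`` (fun=> [set: nat])); last first.
  by apply/seteqP; split.
rewrite -(esum_esum (a := fun k j => (\prod_i (u k j 0 i - l k j 0 i))%:E)) //.
rewrite -nneseries_esumT; last by move=> k; apply: esum_ge0.
apply: le_trans (epsilon_trick0 xpredT (ltW e0)).
apply: lee_nneseries => [k _ _|k _]; first exact: esum_ge0.
by rewrite -nneseries_esumT //; have [] := lu k.
Qed.

Lemma lebesgue_null_countable_cover (T : countType) (S : T -> set V) (S' : set V) :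
  (forall k, lebesgue_null (S k)) -> S' `<=` \bigcup_k S k -> lebesgue_null S'.
Proof.
move=> S0 S'S.
have null0 : @lebesgue_null R N.+1 set0.
  apply: lebesgue_null_finite_covers => eps e0; exists [::]; split=> //.
  by rewrite big_nil ltW.
have := @lebesgue_null_bigcup
  (fun k => if unpickle k is Some t then S t else set0).
have h k : lebesgue_null (if @unpickle T k is Some t then S t else set0).
  by case: unpickle.
move=> /(_ h) nul eps /nul[l [u [lu cov vol]]]; exists l, u; split=> //.
move=> v /S'S[t _ Stv]; apply: cov; exists (pickle t) => //.
by rewrite pickleK.
Qed.

(** The last cell is there for the right end point [M] of the interval. *)
Lemma grid_cell (M : R) K (x : R) : 0 < M -> `|x| <= M ->
  let h := 2 * M / K.+1%:R in
  exists k : 'I_K.+2, - M + k%:R * h <= x <= - M + k%:R * h + h.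
Proof.
move=> M0; rewrite ler_norml => /andP[xl xu] h.
have h0 : 0 < h by rewrite divr_gt0 ?mulr_gt0 ?ltr0Sn.
have xM : 0 <= (x + M) / h by rewrite divr_ge0 ?(ltW h0) //; lra.
have /andP[k1 k2] := truncn_itv xM.
have kK : (Num.truncn ((x + M) / h) < K.+2)%N.
  rewrite ltnS -(@ler_nat R); apply: le_trans k1 _.
  rewrite ler_pdivrMr // /h mulrCA divff ?pnatr_eq0 // mulr1; lra.
exists (Ordinal kK) => /=; move: k1 k2; set k := Num.truncn _.
rewrite ler_pdivlMr // ltr_pdivrMr // -[k.+1]addn1 natrD mulrDl mul1r => a b.
by apply/andP; split; lra.
Qed.

(** Cut the other coordinates into cells of side [h].  Over one cell the set has
    height [O(h)], so the boxes needed have total volume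
    [O(h^-N) * h^N * O(h) = O(h)]. *)
Lemma lebesgue_null_lipschitz_graph (S : set V) (i0 : 'I_N.+1) (M L : R) :
  0 < M -> 0 <= L ->
  (forall c, S c -> forall i, `|c 0 i| <= M) ->
  (forall c c', S c -> S c' -> `|c 0 i0 - c' 0 i0| <=
     L * \sum_(j < N) `|c 0 (lift i0 j) - c' 0 (lift i0 j)|) ->
  lebesgue_null S.
Proof.
move=> M0 L0 SM SL; apply: lebesgue_null_finite_covers => eps e0.
pose C := (4 * M) ^+ N * (2 * (L * N%:R)) * (2 * M).
have [K _ /(_ K (leqnn K)) /= CK] := near_harmonic C e0.
pose h := 2 * M / K.+1%:R.
have h0 : 0 < h by rewrite divr_gt0 ?mulr_gt0 ?ltr0Sn.
pose cell (g : {ffun 'I_N -> 'I_K.+2}) (c : V) := forall j,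
  - M + (g j)%:R * h <= c 0 (lift i0 j) <= - M + (g j)%:R * h + h.
pose corner (g : {ffun 'I_N -> 'I_K.+2}) (x : R) (y : R) : V :=
  \row_i if unlift i0 i is Some j then - M + (g j)%:R * h + y else x.
have cornerl g x y j : corner g x y 0 (lift i0 j) = - M + (g j)%:R * h + y.
  by rewrite mxE liftK.
have corner0 g x y : corner g x y 0 i0 = x by rewrite mxE unlift_none.
pose c0 g : V := xget 0 [set c | S c /\ cell g c].
pose r := L * (N%:R * h).
have r0 : 0 <= r by rewrite !mulr_ge0 // ltW.
pose b g := (corner g (c0 g 0 i0 - r) 0, corner g (c0 g 0 i0 + r) h).
have volb g : volume (b g) = 2 * r * h ^+ N.
  rewrite /volume (bigD1_ord i0) //= !corner0; congr (_ * _); first by lra.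
  rewrite (eq_bigr (fun=> h)) ?prodr_const ?card_ord // => j _.
  by rewrite !cornerl; lra.
exists [seq b g | g <- enum {ffun 'I_N -> 'I_K.+2}]; split.
- move=> _ /mapP[g _ ->] i; case: (unliftP i0 i) => [j|] -> /=.
    by rewrite !cornerl; lra.
  by rewrite !corner0; lra.
- move=> c Sc.
  have /choice[g hg] := fun j => grid_cell K M0 (SM _ Sc (lift i0 j)).
  have cg : cell (finfun g) c by move=> j; rewrite ffunE; apply: hg.
  exists (b (finfun g)); first by apply/mapP; exists (finfun g); rewrite ?mem_enum.
  have [Sc0 c0g] : [set c | S c /\ cell (finfun g) c] (c0 (finfun g)).
    by apply: xgetPex; exists c.
  move=> i; case: (unliftP i0 i) => [j|] -> /=.
    by rewrite !cornerl addr0; apply: cg.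
  rewrite !corner0; have := SL _ _ Sc Sc0.
  have : L * \sum_(j < N) `|c 0 (lift i0 j) - c0 (finfun g) 0 (lift i0 j)| <= r.
    rewrite ler_wpM2l // mulr_natl -[X in _ <= _ *+ X]card_ord -sumr_const.
    apply: ler_sum => j _; rewrite ler_norml.
    have /andP[a1 a2] := cg j; have /andP[b1 b2] := c0g j.
    by apply/andP; split; lra.
  move=> le1 /le_trans/(_ le1); rewrite ler_norml => /andP[a1 a2].
  by apply/andP; split; lra.
rewrite big_map big_enum /= (eq_bigr (fun=> 2 * r * h ^+ N)) //.
rewrite sumr_const card_ffun !card_ord; apply: le_trans CK.
rewrite -(mulr_natl (2 * r * h ^+ N)) natrX.
have Kh : K.+2%:R * h <= 4 * M.
  rewrite /h mulrA ler_pdivrMr ?ltr0Sn // -[K.+2]addn1 natrD -natr1.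
  have := ler0n R K; move: K%:R => x x0.
  have : 0 <= x * M by rewrite mulr_ge0 // ltW.
  lra.
have -> : K.+2%:R ^+ N * (2 * r * h ^+ N) = (K.+2%:R * h) ^+ N * (2 * r).
  by rewrite [in RHS]exprMn [LHS]mulrA mulrAC.
have -> : C / K.+1%:R = (4 * M) ^+ N * (2 * r).
  by rewrite /C /r /h -!mulrA; do !congr (_ * _); ring.
apply: ler_wpM2r; first by rewrite mulr_ge0.
by apply: lerXn2r => //; rewrite nnegrE mulr_ge0 // ltW.
Qed.

(** If [w], [w'] minimize the objectives [c], [c'] then
    [<c' - c, w' - w> <= 0].  So the objectives that have, for fixed [q1 < q2],
    a minimizer with [i]-th coordinate at most [q1] and one with [i]-th
    coordinate at least [q2] lie on the graph of a Lipschitz function of the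
    other coordinates.  Two different minimizers
    are separated in this way by rational [q1 < q2]. *)
Lemma lebesgue_null_multiple_minimizers (K : set V) (B : R) :
  (forall w, K w -> forall i, `|w 0 i| <= B) ->
  lebesgue_null
    [set c | exists w w', [/\ minimizes K c w, minimizes K c w' & w <> w']].
Proof.
move=> KB.
pose S (t : 'I_N.+1 * rat * rat * nat) : set V :=
  let: (i, q1, q2, M) := t in
  [set c : V | [/\ ratr q1 < ratr q2 :> R, forall j, `|c 0 j| <= M%:R &
    exists w w', [/\ minimizes K c w, minimizes K c w',
      w 0 i <= ratr q1 & ratr q2 <= w' 0 i]]].
apply: (@lebesgue_null_countable_cover _ S).
  move=> [[[i q1] q2] M].
  have [q12|q12] := ltP (ratr q1 : R) (ratr q2); last first.
    apply: lebesgue_null_finite_covers => eps e0; exists [::].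
    split=> //; last by rewrite big_nil ltW.
    by move=> c [/lt_le_trans/(_ q12)]; rewrite ltxx.
  pose del : R := ratr q2 - ratr q1.
  have d0 : 0 < del by rewrite subr_gt0.
  have lip c c' : S (i, q1, q2, M) c -> S (i, q1, q2, M) c' ->
      c' 0 i - c 0 i <=
      2 * `|B| / del * \sum_(j < N) `|c 0 (lift i j) - c' 0 (lift i j)|.
    move=> [_ _ [w [w' [wm w'm wq wq']]]] [_ _ [v [v' [vm v'm vq vq']]]].
    have [c'c|cc'] := leP (c' 0 i) (c 0 i).
      apply: le_trans (_ : 0 <= _); first by rewrite subr_le0.
      by rewrite mulr_ge0 ?sumr_ge0 // divr_ge0 ?mulr_ge0 // ltW.
    have h1 := wm.2 _ v'm.1; have h2 := v'm.2 _ wm.1.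
    have : \sum_j (c' 0 j - c 0 j) * (v' 0 j - w 0 j) <= 0.
      have -> : \sum_j (c' 0 j - c 0 j) * (v' 0 j - w 0 j)
         = (dot c' v' - dot c' w) - (dot c v' - dot c w).
        rewrite /dot -!sumrB; apply: eq_bigr => j _; ring.
      lra.
    rewrite (bigD1_ord i) //= => le0.
    have le1 : (c' 0 i - c 0 i) * del <=
        2 * `|B| * \sum_(j < N) `|c 0 (lift i j) - c' 0 (lift i j)|.
      apply: le_trans (_ : (c' 0 i - c 0 i) * (v' 0 i - w 0 i) <= _).
        by rewrite ler_wpM2l ?subr_ge0 ?(ltW cc') // /del; lra.
      apply: le_trans (_ : - \sum_(j < N) (c' 0 (lift i j) - c 0 (lift i j)) *
          (v' 0 (lift i j) - w 0 (lift i j)) <= _); first by lra.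
      rewrite -sumrN mulr_sumr; apply: ler_sum => j _.
      apply: le_trans (ler_norm _) _; rewrite normrN normrM distrC mulrC.
      rewrite ler_wpM2r //; apply: le_trans (ler_normB _ _) _.
      have := KB _ v'm.1 (lift i j); have := KB _ wm.1 (lift i j).
      have := ler_norm B; lra.
    by rewrite mulrAC ler_pdivlMr.
  apply: (@lebesgue_null_lipschitz_graph _ i M.+1%:R (2 * `|B| / del)).
  - exact: ltr0Sn.
  - by rewrite divr_ge0 ?mulr_ge0 // ltW.
  - by move=> c [_ cM _] j; rewrite (le_trans (cM j)) // ler_nat.
  move=> c c' Sc Sc'; have h1 := lip _ _ Sc Sc'; have h2 := lip _ _ Sc' Sc.
  rewrite ler_norml; apply/andP; split; first by lra.
  apply: le_trans h2 _; rewrite le_eqVlt; apply/orP; left; apply/eqP.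
  by congr (_ * _); apply: eq_bigr => j _; rewrite distrC.
move=> c [w [w' [wm w'm ww']]].
have [i wi] : exists i, w 0 i != w' 0 i.
  apply: contrapT => h; apply: ww'; apply/rowP => i.
  by apply/eqP; apply: contrapT => /negP wi; apply: h; exists i.
pose M := \sum_j `|c 0 j|.
have cM j : `|c 0 j| <= (Num.bound M)%:R.
  have M0 : 0 <= M by rewrite sumr_ge0.
  apply: le_trans (ltW (archi_boundP M0)).
  by rewrite /M (bigD1 j) //= lerDl sumr_ge0.
have mem x y : minimizes K c x -> minimizes K c y -> x 0 i < y 0 i ->
    (\bigcup_t S t) c.
  move=> xm ym /rat_in_itvoo[q1]; rewrite in_itv /= => /andP[xq1].
  move=> /rat_in_itvoo[q2]; rewrite in_itv /= => /andP[q12 q2y].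
  exists (i, q1, q2, Num.bound M) => //; split=> //.
  by exists x, y; split=> //; exact: ltW.
by case: (ltgtP (w 0 i) (w' 0 i)) wi => // wi _; [apply: mem wi|apply: mem wi].
Qed.

End NullSets.

Lemma lebesgue_null_minimizers (R : realType) N (K : set 'rV[R]_N) (B : R) :
  (0 < N)%N -> (forall w, K w -> forall i, `|w 0 i| <= B) ->
  lebesgue_null
    [set c | exists w w', [/\ minimizes K c w, minimizes K c w' & w <> w']].
Proof. by case: N K => // N K _; apply: lebesgue_null_multiple_minimizers. Qed.

(** * Truncated moment sequences *)

Section Truncation.
Variables (R : realType) (m : nat).
Implicit Types (w : multinom m -> R) (a b : multinom m) (p q : mpoly m R).

Definition tms_of e w : tms R m e := \row_i w (bmnm (enum_val i)).

Lemma tms_at_of e w a : (mdeg a <= e)%N -> tms_at (tms_of e w) a = w a.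
Proof.
move=> ae; have ae' : (mdeg a < e.+1)%N by [].
by rewrite /tms_at insubT mxE enum_rankK.
Qed.

Lemma tms_at_out e (z : tms R m e) a : (e < mdeg a)%N -> tms_at z a = 0.
Proof. by move=> ea; rewrite /tms_at insubN // -leqNgt. Qed.

Lemma eq_pairing p e w w' : (msize p <= e.+1)%N ->
  (forall a, (mdeg a <= e)%N -> w a = w' a) -> pairing p w = pairing p w'.
Proof.
move=> pe ww'; rewrite !(pairing_bound _ pe); apply: eq_bigr => a _.
by rewrite ww' // -ltnS bmdeg.
Qed.

Lemma pairing_tms_of e w p : (msize p <= e.+1)%N ->
  pairing p (tms_at (tms_of e w)) = pairing p w.
Proof. by move=> pe; apply: (eq_pairing pe) => a; exact: tms_at_of. Qed.

Lemma dot_coef_vec e p w : (msize p <= e.+1)%N ->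
  dot (coef_vec e p) (tms_of e w) = pairing p w.
Proof.
move=> pe; rewrite (pairing_bound _ pe) /dot.
rewrite [RHS](reindex _ (onW_bij _ (enum_val_bij _))) /=.
by apply: eq_bigr => i _; rewrite !mxE.
Qed.

Lemma msizeM_bound p q k l : (msize p <= k.+1)%N -> (msize q <= l.+1)%N ->
  (msize (p * q) <= (k + l).+1)%N.
Proof.
move=> pk ql; have [->|p0] := eqVneq p 0; first by rewrite mul0r msize0.
have [->|q0] := eqVneq q 0; first by rewrite mulr0 msize0.
rewrite msizeM //; move: pk ql; move: (mmeasure _ p) (mmeasure _ q) => x y; lia.
Qed.

Lemma psd_localizing q k w : psd_mx (localizing_mx q k w) <->
  forall h, (msize h <= (loc_order q k).+1)%N -> 0 <= pairing (q * h ^+ 2) w.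
Proof.
split=> [[_ pos] h hk|pos].
  by rewrite (localizing_mxP _ hk).
split; first exact: localizing_mxT.
move=> v; pose I := bmultinom m (loc_order q k).+1.
pose h : mpoly m R := \sum_(b : I) v (enum_rank b) 0 *: mpolyX R (bmnm b).
have hk : (msize h <= (loc_order q k).+1)%N.
  apply: leq_trans (msize_sum _ _ _) _; apply/bigmax_leqP => b _.
  by rewrite (leq_trans (msizeZ_le _ _)) // msizeX bmdeg.
have := pos h hk; rewrite (localizing_mxP _ hk).
have -> // : \col_i mcoeff (bmnm (enum_val i)) h = v.
apply/colP => i; rewrite mxE /h raddf_sum (bigD1 (enum_val i)) //=.
rewrite mcoeffZ mcoeffX eqxx mulr1 enum_valK big1 ?addr0 // => b bi.
rewrite mcoeffZ mcoeffX; case: eqVneq => [e|_]; last by rewrite mulr0.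
by case/eqP: bi; apply: val_inj.
Qed.

Lemma mnm_predecessor a k : mdeg a = k.+1 ->
  exists b i, a = mnm_add b (mnm1 i) /\ mdeg b = k.
Proof.
move=> ak; have : mdeg a != 0%N by rewrite ak.
rewrite mdegE sum_nat_eq0 negb_forall => /existsP[i /= ai].
have ab : a = mnm_add (mnm_sub a (mnm1 i)) (mnm1 i).
  rewrite submK //; apply/mnm_lepP => j; rewrite mnm1E.
  by case: eqVneq => // <-; rewrite lt0n.
exists (mnm_sub a (mnm1 i)), i; split=> //.
by move: ak; rewrite {1}ab mdegD mdeg1 addn1 => -[].
Qed.

Lemma mnm_split a j : (j <= mdeg a)%N ->
  exists b c, a = mnm_add b c /\ mdeg b = j.
Proof.
elim: j => [_|j IHj ja].
  by exists mnm0, a; rewrite mdeg0 add0m.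
have [b [c [abc bj]]] := IHj (ltnW ja).
have [k ck] : exists k, mdeg c = k.+1.
  exists (mdeg c).-1; rewrite prednK //.
  by move: ja; rewrite abc mdegD bj -addn1 leq_add2l.
have [c' [i [cc' _]]] := mnm_predecessor ck.
exists (mnm_add b (mnm1 i)), c'; split; last by rewrite mdegD mdeg1 bj addn1.
by rewrite abc cc' -addmA [mnm_add (mnm1 i) _]addmC.
Qed.

(** The ball constraint gives [w (2 b + 2 e_i) <= w (2 b)], hence
    [w (2 b) <= w 0]; the squares of [x^b +- x^c] extend the bound to all
    [w (b + c)]. *)
Lemma moment_bound k w :
  (forall h, (msize h <= k.+1)%N -> 0 <= pairing (h ^+ 2) w) ->
  (forall h, (msize h <= k)%N ->
     0 <= pairing ((1 - \sum_(i < m) var i ^+ 2) * h ^+ 2) w) ->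
  forall a, (mdeg a <= k.*2)%N -> `|w a| <= w mnm0.
Proof.
move=> sq ball.
have sqX b : mpolyX R b ^+ 2 = mpolyX R (mnm_add b b).
  by rewrite expr2 mpolyXD.
have even0 b : (mdeg b <= k)%N -> 0 <= w (mnm_add b b).
  by move=> bk; have := sq (mpolyX R b); rewrite msizeX ltnS sqX pairingX; apply.
have even b : (mdeg b <= k)%N -> w (mnm_add b b) <= w mnm0.
  have [l] := ubnP (mdeg b); elim: l b => // l IHl b bl bk.
  case bj: (mdeg b) => [|j].
    by move/eqP: bj; rewrite mdeg_eq0 => /eqP ->; rewrite addm0.
  have [c [i [bc cj]]] := mnm_predecessor bj.
  have ck : (mdeg c < k)%N by rewrite cj -bj.
  apply: le_trans (IHl c _ (ltnW ck)); last by rewrite cj -ltnS -bj.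
  have := ball (mpolyX R c); rewrite msizeX => /(_ ck).
  rewrite mulrBl mul1r pairingB sqX pairingX mulr_suml pairing_sum subr_ge0.
  apply: le_trans; rewrite (bigD1 i) //= -[X in X <= _]addr0.
  have term j' : pairing (var j' ^+ 2 * mpolyX R (mnm_add c c)) w
      = w (mnm_add (mnm_add c (mnm1 j')) (mnm_add c (mnm1 j'))).
    by rewrite -sqX -exprMn /var -mpolyXD sqX pairingX [mnm_add (mnm1 _) _]addmC.
  rewrite term -bc lerD // sumr_ge0 // => j' _; rewrite term even0 //.
  by rewrite mdegD mdeg1 addn1.
move=> a ak.
have [b [c [-> [bk ck]]]] : exists b c,
    a = mnm_add b c /\ (mdeg b <= k)%N /\ (mdeg c <= k)%N.
  have [b [c [abc bj]]] := @mnm_split a (minn k (mdeg a)) (geq_minr _ _).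
  exists b, c; split=> //; move: ak; rewrite abc mdegD bj geq_minl.
  by move: bj; rewrite abc mdegD; lia.
have sz : (msize (mpolyX R b) <= k.+1)%N && (msize (mpolyX R c) <= k.+1)%N.
  by rewrite !msizeX !ltnS bk ck.
have expand (s : R) : s ^+ 2 = 1 ->
    - (w mnm0 + w mnm0) <= s * (w (mnm_add b c) + w (mnm_add b c)).
  move=> s2; have := sq (mpolyX R b + s *: mpolyX R c).
  have -> : (mpolyX R b + s *: mpolyX R c) ^+ 2 = mpolyX R (mnm_add b b)
      + s *: (mpolyX R (mnm_add b c) + mpolyX R (mnm_add b c))
      + mpolyX R (mnm_add c c).
    rewrite sqrrD exprZn s2 scale1r !sqX -scalerAr -mpolyXD mulr2n scalerDr.
    by [].
  rewrite !pairingD pairingZ pairingD !pairingX => pos.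
  have : (msize (mpolyX R b + s *: mpolyX R c) <= k.+1)%N.
    apply: leq_trans (msizeD_le _ _) _; rewrite geq_max; case/andP: sz => -> /=.
    exact: leq_trans (msizeZ_le _ _).
  move=> /pos; have := even b bk; have := even c ck; lra.
have := expand 1 (expr1n _ _).
have := expand (-1) (etrans (sqrrN 1) (expr1n _ 2)).
rewrite mulN1r mul1r ler_norml => h1 h2; apply/andP; split; lra.
Qed.

End Truncation.

(** * Feasible points of the semidefinite programs *)

Section Localizers.
Variables (R : realType) (m : nat).

Definition slack : mpoly m R := 1 - \sum_(i < m) var i.
Definition ball_poly : mpoly m R := 1 - \sum_(i < m) var i ^+ 2.

(** The four kinds of polynomials whose localizing matrices occur in the
    constraints of the program. *)
Definition localizer (q : mpoly m R) :=
  [\/ q = 1, exists i, q = var i, q = slack | q = ball_poly].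

Lemma simplex_tmsP k (z : tms R m k.*2) : simplex_tms z <->
  forall q, localizer q -> forall h, (msize h <= (loc_order q k).+1)%N ->
    0 <= pairing (q * h ^+ 2) (tms_at z).
Proof.
split=> [[/psd_localizing H1 Hv /psd_localizing Hs /psd_localizing Hb] q|H].
  by case=> [->|[i ->]|->|->] //; apply/psd_localizing.
split=> [|i||]; apply/psd_localizing; apply: H.
- by constructor 1.
- by constructor 2; exists i.
- by constructor 3.
- by constructor 4.
Qed.

Lemma msize_var (i : 'I_m) : msize (var i : mpoly m R) = 2.
Proof. by rewrite msizeX mdeg1. Qed.

Lemma msize_localizer q : localizer q -> (msize q <= 3)%N.
Proof.
have one_sub (F : 'I_m -> mpoly m R) : (forall i, msize (F i) <= 3)%N ->
    (msize (1 - \sum_i F i) <= 3)%N.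
  move=> F3; apply: leq_trans (msizeD_le _ _) _; rewrite geq_max msize1 msizeN /=.
  by apply: leq_trans (msize_sum _ _ _) _; apply/bigmax_leqP => i _.
case=> [->|[i ->]|->|->]; rewrite ?msize1 ?msize_var //; apply: one_sub => i.
  by rewrite msize_var.
by rewrite expr2 (@msizeM_bound _ _ _ _ 1 1) // msize_var.
Qed.

Lemma loc_order_ge q k : localizer q -> (k <= (loc_order q k).+1)%N.
Proof.
move=> /msize_localizer; rewrite /loc_order; move: (mmeasure _ q) => s s3.
by have : (uphalf s.-1 <= 1)%N; [case: s s3 => [|[|[|[|]]]]|lia].
Qed.

Lemma localizer_ge0 q u : localizer q -> in_simplex u -> 0 <= meval u q.
Proof.
move=> lq [u0 u1].
have sumE (F : 'I_m -> mpoly m R) :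
    meval u (1 - \sum_i F i) = 1 - \sum_i meval u (F i).
  by rewrite mevalB meval1; congr (_ - _); apply: raddf_sum.
case: lq => [->|[i ->]|->|->]; rewrite ?sumE.
- by rewrite meval1.
- by rewrite mevalXU.
- by rewrite subr_ge0 (eq_bigr u) // => i _; exact: mevalXU.
- rewrite subr_ge0; apply: (le_trans _ u1); apply: ler_sum => i _.
  rewrite expr2 mevalM !mevalXU -[leRHS]mulr1 ler_wpM2l //.
  by move: u1; rewrite (bigD1 i) //=; apply: le_trans; rewrite lerDl sumr_ge0.
Qed.

End Localizers.

Section Feasibility.
Variables (R : realType) (d m : nat) (A : tensor R d m.+1).
Implicit Types (w : multinom m -> R).

Definition moment_functional w := moment_cond A w /\ simplex_nonneg w.

Local Notation feasible k z := (@Pk_feasible R m.+1 d A k z).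

Lemma feasible_of_functional k w : (0 < k)%N -> (d <= k.*2)%N ->
  moment_functional w -> feasible k (tms_of k.*2 w).
Proof.
move=> k0 dk [Aw w0]; split=> [a ad|].
  by rewrite tms_at_of ?Aw // (leq_trans ad).
apply/simplex_tmsP => q lq h hk; have sq := msize_localizer lq.
rewrite pairing_tms_of; last first.
  have := hk; rewrite /loc_order => hk'.
  have sh2 := @msizeM_bound _ _ _ _ _ _ hk' hk'.
  have sq' : (msize q <= (msize q).-1.+1)%N by exact: leqSpred.
  apply: leq_trans (msizeM_bound sq' sh2) _; rewrite ltnS.
  move: sq; move: (mmeasure _ q) => s s3.
  by case: s s3 => [|[|[|[|]]]] //= _; move: k0; rewrite /uphalf -?addnn /=; lia.
apply: w0 => u us; rewrite expr2 !mevalM mulr_ge0 ?localizer_ge0 //.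
by rewrite -expr2 sqr_ge0.
Qed.

(** The value at the multi-index 0 that the equality constraints impose: the
    total mass of a representing measure. *)
Definition mass :=
  pairing (@bar_monomial R m.+1 mnm0 * (\sum_(i < m.+1) var i) ^+ d) (phi A).

Lemma feasible_bound k (z : tms R m k.*2) : (0 < k)%N -> feasible k z ->
  forall a, `|tms_at z a| <= `|mass|.
Proof.
move=> k0 [cond /simplex_tmsP Sz] a.
have [ak|ka] := leqP (mdeg a) k.*2; last by rewrite tms_at_out // normr0.
have <- : tms_at z mnm0 = mass by rewrite cond ?mdeg0 // subn0.
apply: le_trans (ler_norm _); apply: (@moment_bound _ _ k) => // h hk.
  rewrite -[_ ^+ 2]mul1r; apply: Sz; first by constructor 1.
  by rewrite /loc_order msize1 subn0.
apply: Sz; first by constructor 4.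
by apply: leq_trans hk (loc_order_ge _ _); constructor 4.
Qed.

Section Limits.
Variables (U : set_system nat).
Context {UU : UltraFilter U}.
Variables (ws : nat -> multinom m -> R) (l : multinom m -> R).
Hypothesis wsl : forall a, (fun k => ws k a) @ U --> l a.

Lemma cvg_pairing p : (fun k => pairing p (ws k)) @ U --> pairing p l.
Proof. by apply: cvg_bigsum => a _; apply: cvgM => //; apply: cvg_cst. Qed.

Lemma pairing_limit_ge0 p : (\forall k \near U, 0 <= pairing p (ws k)) ->
  0 <= pairing p l.
Proof. by move=> h; apply: cvgr_to_ge (@cvg_pairing p) h. Qed.

Lemma limit_eq a (c : R) : (\forall k \near U, ws k a = c) -> l a = c.
Proof.
move=> h; apply/eqP; rewrite eq_le; apply/andP; split.
  by apply: (cvgr_to_le (@wsl a)); apply: filterS h => k ->.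
by apply: (cvgr_to_ge (@wsl a)); apply: filterS h => k ->.
Qed.

End Limits.

(** Each localizing inequality for a fixed polynomial [h] holds for all large
    orders, so it passes to the limit without restriction on the degree. *)
Lemma feasible_limit (U : set_system nat) {UU : UltraFilter U}
    (kap : nat -> nat) (z : forall k, tms R m (kap k).*2) l :
  (forall a, (fun k => tms_at (z k) a) @ U --> l a) ->
  (forall K, \forall k \near U, (K <= kap k)%N) ->
  (\forall k \near U, feasible (kap k) (z k)) ->
  moment_functional l.
Proof.
move=> zl kapU feasU.
have loc q : localizer q -> op_nonneg l q.
  move=> lq h; apply: (pairing_limit_ge0 zl).
  apply: filterS2 (kapU (msize h)) feasU => k hk [_ /simplex_tmsP]; apply=> //.
  exact: leq_trans hk (loc_order_ge _ lq).
split.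
  move=> a ad; apply: (limit_eq zl); apply: filterS feasU => k [cond _].
  exact: cond.
apply: simplex_positivity => [i|]; apply: loc; first by constructor 2; exists i.
by constructor 3.
Qed.

Lemma feasible_closed k (U : set_system nat) {UU : UltraFilter U}
    (z : nat -> tms R m k.*2) l :
  (forall a, (fun j => tms_at (z j) a) @ U --> l a) ->
  (forall j, feasible k (z j)) ->
  feasible k (tms_of k.*2 l) /\ tms_at (tms_of k.*2 l) = l.
Proof.
move=> zl feas.
have lE : tms_at (tms_of k.*2 l) = l.
  apply/funext => a; have [ak|ka] := leqP (mdeg a) k.*2; first exact: tms_at_of.
  rewrite tms_at_out //; apply/esym/(limit_eq zl); apply: filterE => j.
  exact: tms_at_out.
split=> //; split=> [a ad|].
  rewrite lE; apply: (limit_eq zl); apply: filterE => j.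
  by have [cond _] := feas j; apply: cond.
apply/simplex_tmsP => q lq h hk; rewrite lE; apply: (pairing_limit_ge0 zl).
by apply: filterE => j; have [_ /simplex_tmsP] := feas j; apply.
Qed.

Lemma feasible_cvg (U : set_system nat) {UU : UltraFilter U}
    (kap : nat -> nat) (z : forall k, tms R m (kap k).*2) :
  (\forall k \near U, (0 < kap k)%N /\ feasible (kap k) (z k)) ->
  exists l : multinom m -> R, forall a, (fun k => tms_at (z k) a) @ U --> l a.
Proof.
move=> feasU.
have /choice[l hl] (a : multinom m) :
    exists y : R, (fun k => tms_at (z k) a) @ U --> y.
  apply: (@ultra_cvg _ _ _ _ `|mass|); apply: filterS feasU => k [k0 fk].
  exact: feasible_bound fk a.
by exists l.
Qed.

Lemma minimizer_exists k (p : mpoly m R) : (0 < k)%N ->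
  (exists z, feasible k z) -> exists z, @Pk_minimizer R m.+1 d A p k z.
Proof.
move=> k0 [z0 fz0].
pose E := [set pairing p (tms_at z) | z in [set z | feasible k z]].
have infE : has_inf E.
  split; first by exists (pairing p (tms_at z0)), z0.
  exists (- \sum_(a <- msupp p) `|mcoeff a p| * `|mass|) => _ [z fz <-].
  rewrite lerNl; apply: le_trans (ler_norm _) _; rewrite normrN.
  apply: le_trans (ler_norm_sum _ _ _) _; apply: ler_sum => a _.
  by rewrite normrM ler_wpM2l //; apply: feasible_bound.
have /choice[z hz] j : exists z, feasible k z /\
    pairing p (tms_at z) <= inf E + 1 / j.+1%:R.
  have j0 : 0 < 1 / j.+1%:R :> R by rewrite divr_gt0 // ltr0Sn.
  by have [_ [z fz <-] /ltW zE] := inf_adherent j0 infE; exists z.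
have [U [UU oU]] := free_ultrafilter.
have [l zl] : exists l : multinom m -> R, forall a,
    (fun j => tms_at (z j) a) @ U --> l a.
  apply: (@feasible_cvg U UU (fun=> k) z); apply: filterE => j; split=> //.
  by have [] := hz j.
have [fl lE] := feasible_closed zl (fun j => (hz j).1).
exists (tms_of k.*2 l); split=> // z' fz'; rewrite lE.
apply: le_trans (_ : inf E <= _); last first.
  by apply: ge_inf; [exact: infE.2|exists z'].
apply/ler_addgt0Pr => eps e0; apply: cvgr_to_le (cvg_pairing zl (p := p)) _.
apply: filterS (oU _ (near_harmonic 1 e0)) => j je.
by apply: le_trans (hz j).2 _; rewrite lerD2l.
Qed.

End Feasibility.

(** * Flat extension at unique minimizers *)

Section Flatness.
Variables (R : realType) (m : nat).
Implicit Types (w : multinom m -> R) (f g : mpoly m R).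

Definition annihilates w g e :=
  forall a, (mdeg a <= e)%N -> pairing (g * mpolyX R a) w = 0.

Definition hankel_mx w p q :
    'M[R]_(#|{: bmultinom m p.+1}|, #|{: bmultinom m q.+1}|) :=
  \matrix_(i, j) w (mnm_add (bmnm (enum_val i)) (bmnm (enum_val j))).

Lemma hankel_mx_tr w p q : (hankel_mx w p q)^T = hankel_mx w q p.
Proof. by apply/matrixP => i j; rewrite !mxE addmC. Qed.

Lemma eq_hankel_mx w w' p q :
  (forall a, (mdeg a <= p + q)%N -> w a = w' a) ->
  hankel_mx w p q = hankel_mx w' p q.
Proof.
move=> ww'; apply/matrixP => i j; rewrite !mxE ww' //.
by rewrite mdegD leq_add // -ltnS bmdeg.
Qed.

Lemma rank_moment_mx w k : \rank (moment_mx k w) = \rank (hankel_mx w k k).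
Proof.
have -> : moment_mx k w = hankel_mx w (loc_order 1 k) (loc_order 1 k).
  by apply/matrixP => i j; rewrite !mxE mul1r pairingX.
by rewrite /loc_order msize1 subn0.
Qed.

(** Ranks are compared through left kernels, which are the spaces of polynomials
    orthogonal to given degrees ([row_mul_hankel]). *)
Lemma eq_kernel_rank (F : fieldType) k l l'
    (B : 'M[F]_(k, l)) (C : 'M[F]_(k, l')) :
  (forall v : 'rV_k, v *m B = 0 <-> v *m C = 0) -> \rank B = \rank C.
Proof.
move=> BC; have ker : (kermx B == kermx C)%MS.
  apply/andP; split; apply/rV_subP => v /sub_kermxP h; apply/sub_kermxP;
  by apply/BC.
have := mxrank_ker B; rewrite (eqmxP ker) mxrank_ker => h.
by rewrite -(subKn (rank_leq_row B)) -h subKn // rank_leq_row.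
Qed.

Definition poly_of_row p (v : 'rV[R]_#|{: bmultinom m p.+1}|) : mpoly m R :=
  \sum_i v 0 i *: mpolyX R (bmnm (enum_val i)).

Lemma row_mul_hankel w p q (v : 'rV_#|{: bmultinom m p.+1}|) :
  v *m hankel_mx w p q = 0 <-> annihilates w (poly_of_row v) q.
Proof.
have E a : pairing (poly_of_row v * mpolyX R a) w
    = \sum_i v 0 i * w (mnm_add (bmnm (enum_val i)) a).
  rewrite /poly_of_row mulr_suml pairing_bigsum; apply: eq_bigr => i _.
  by rewrite -scalerAl pairingZ -mpolyXD pairingX.
split=> [v0 a aq|van].
  have aq' : (mdeg a < q.+1)%N by [].
  have := congr1 (fun M : 'rV[R]_#|{: bmultinom m q.+1}| =>
    M 0 (enum_rank (BMultinom aq'))) v0.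
  rewrite mxE [in RHS]mxE => H; rewrite E -[RHS]H; apply: eq_bigr => i _.
  by rewrite mxE enum_rankK.
apply/rowP => j; rewrite !mxE -[RHS](van (bmnm (enum_val j))); last first.
  by rewrite -ltnS bmdeg.
by rewrite E; apply: eq_bigr => i _; rewrite mxE.
Qed.

(** Passing from [d] to [d + 1] keeps the left kernel, so columns can be added
    without changing the rank; by symmetry so can rows. *)
Lemma flat_rank w d :
  (forall g, annihilates w g d -> annihilates w g d.+1) ->
  \rank (hankel_mx w d.+1 d.+1) = \rank (hankel_mx w d d).
Proof.
move=> step.
have stab p : \rank (hankel_mx w p d.+1) = \rank (hankel_mx w p d).
  apply: eq_kernel_rank => v; rewrite !row_mul_hankel; split; last exact: step.
  by move=> h a ad; apply: h; apply: leqW.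
by rewrite stab -mxrank_tr hankel_mx_tr stab.
Qed.

(** The moments of the measure with density [1 + eps g]. *)
Definition perturb w (g : mpoly m R) (eps : R) (a : multinom m) :=
  pairing ((1 + eps *: g) * mpolyX R a) w.

Lemma pairing_perturb w g eps f :
  pairing f (perturb w g eps) = pairing ((1 + eps *: g) * f) w.
Proof.
rewrite [f in RHS]mpolyE mulr_sumr pairing_bigsum; apply: eq_bigr => a _.
by rewrite -scalerAr pairingZ.
Qed.

Lemma simplex_bounded g : exists2 C : R, 0 < C &
  forall u, in_simplex u -> `|meval u g| <= C.
Proof.
exists (1 + \sum_(a <- msupp g) `|mcoeff a g|) => [|u [u0 u1]].
  by rewrite ltr_pwDl // sumr_ge0.
rewrite mevalE; apply: le_trans (ler_norm_sum _ _ _) _.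
rewrite -[X in X <= _]add0r lerD // ler_sum // => a _.
rewrite normrM ler_piMr // ger0_norm; last first.
  by rewrite prodr_ge0 // => i _; rewrite exprn_ge0.
apply: prodr_ile1 => i _; rewrite exprn_ge0 //= exprn_ile1 //.
by move: u1; rewrite (bigD1 i) //=; apply: le_trans; rewrite lerDl sumr_ge0.
Qed.

End Flatness.

Section UniqueMinimizer.
Variables (R : realType) (d m : nat) (A : tensor R d m.+1).
Variables (e : nat) (p : mpoly m R).
Hypotheses (de : (d < e)%N) (pe : (msize p <= e.+1)%N).

(** The feasible set of the common limit of the programs, seen through the
    coordinates of degree at most [e] that the objective involves. *)
Definition limit_set : set (tms R m e) :=
  [set z | exists2 w, moment_functional A w & z = tms_of e w].

Definition multiple_minimizers : set (tms R m e) :=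
  [set c | exists z z',
    [/\ minimizes limit_set c z, minimizes limit_set c z' & z <> z']].

Hypothesis unique : ~ multiple_minimizers (coef_vec e p).

(** The perturbations of [w] by [g] of both signs keep the constraints, and the
    objective is affine in the size of the perturbation; so it is constant, and
    uniqueness applies to the coordinates of degree [d + 1 <= e]. *)
Lemma minimizer_step w :
  moment_functional A w ->
  (forall w', moment_functional A w' -> pairing p w <= pairing p w') ->
  forall g, annihilates w g d -> annihilates w g d.+1.
Proof.
move=> [Aw w0] wmin g gd.
have [C C0 gC] := simplex_bounded g.
have pert eps : `|eps| <= C^-1 -> moment_functional A (perturb w g eps).
  move=> epsC; split=> [a ad|f f0].
    rewrite -Aw // /perturb mulrDl mul1r pairingD pairingX -scalerAl pairingZ.
    by rewrite gd // mulr0 addr0.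
  rewrite pairing_perturb; apply: w0 => u us.
  rewrite mevalM mulr_ge0 ?f0 // mevalD meval1 mevalZ.
  have : `|eps * meval u g| <= 1.
    rewrite normrM -(mulVf (lt0r_neq0 C0)); apply: ler_pM => //; exact: gC.
  by rewrite ler_norml => /andP[]; lra.
have Ci : 0 <= C^-1 by rewrite invr_ge0 ltW.
have pos := pert C^-1; have neg := pert (- C^-1).
rewrite normrN ger0_norm // lexx in pos neg.
have {}pos := pos isT; have {}neg := neg isT.
have pE eps : pairing p (perturb w g eps)
    = pairing p w + eps * pairing (g * p) w.
  by rewrite pairing_perturb mulrDl mul1r pairingD -scalerAl pairingZ.
have gp0 : C^-1 * pairing (g * p) w = 0.
  have := wmin _ pos; have := wmin _ neg; rewrite !pE; lra.
have minz w' : moment_functional A w' -> pairing p w' = pairing p w ->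
    minimizes limit_set (coef_vec e p) (tms_of e w').
  move=> mw' pw'; split; first by exists w'.
  by move=> _ [w'' mw'' ->]; rewrite !dot_coef_vec // pw'; apply: wmin.
have eqz : tms_of e (perturb w g C^-1) = tms_of e w.
  apply: contrapT => neq; apply: unique.
  exists (tms_of e (perturb w g C^-1)), (tms_of e w); split=> //.
    by apply: minz => //; rewrite pE gp0 addr0.
  by apply: minz => //; split.
move=> a ad; have ae : (mdeg a <= e)%N by exact: leq_trans ad de.
have := congr1 (fun z => tms_at z a) eqz; rewrite !tms_at_of //.
rewrite /perturb mulrDl mul1r pairingD pairingX -scalerAl pairingZ.
move=> /(canRL (addKr _)); rewrite addNr => /eqP.
by rewrite mulf_eq0 invr_eq0 gt_eqF //= => /eqP.
Qed.

End UniqueMinimizer.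

(** * The theorem *)

Lemma degree_lt_double_order d : (d < (uphalf d.+1).*2)%N.
Proof. by rewrite /= -[X in (X < _)%N]odd_double_half; case: odd; lia. Qed.

Lemma mx_norm_bound (R : realType) N (v : 'rV[R]_N) (c : R) : 0 <= c ->
  (forall i, `|v 0 i| <= c) -> `|v| <= c.
Proof.
move=> c0 vc; have -> : `|v| = mx_norm v by []; rewrite mx_normrE.
by apply/bigmax_leP; split=> // -[i j] _ /=; rewrite (ord1 i).
Qed.

Section LimitProblem.
Variables (R : realType) (d m : nat) (A : tensor R d m.+1).

Local Notation d1 := (uphalf d.+1).
Local Notation feasible k z := (@Pk_feasible R m.+1 d A k z).

Lemma limit_set_bounded e (z : tms R m e) :
  limit_set A z -> forall i, `|z 0 i| <= `|mass A|.
Proof.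
move=> [w mw ->] i; pose k := maxn d1 e.
have dk : (d <= k.*2)%N.
  by have := degree_lt_double_order d; rewrite /k; lia.
have k0 : (0 < k)%N by exact: leq_trans (ltn0Sn _) (leq_maxl _ _).
have := feasible_bound k0 (feasible_of_functional k0 dk mw) (bmnm (enum_val i)).
rewrite mxE tms_at_of //; have := bmdeg (enum_val i); rewrite /k; lia.
Qed.

Lemma multiple_minimizers_null e :
  lebesgue_null (@multiple_minimizers R d m A e).
Proof.
apply: lebesgue_null_minimizers; last exact: limit_set_bounded.
by apply/card_gt0P; exists bm0.
Qed.

(** Feasible points at arbitrarily large orders would have a limit functional,
    which represents [A]. *)
Lemma infeasible_of_not_completely_positive : (0 < d)%N -> symmetric_tensor A ->
  ~ completely_positive A ->
  exists K, forall k, (d1 <= k)%N -> (K <= k)%N ->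
    ~ exists z : tms R m k.*2, feasible k z.
Proof.
move=> hd symA ncp; apply: contrapT => feas; apply: ncp.
have /choice[kap hkap] K : exists k, [/\ (d1 <= k)%N, (K <= k)%N &
    exists z : tms R m k.*2, feasible k z].
  apply: contrapT => noK; apply: feas; exists K => k dk Kk fk; apply: noK.
  by exists k.
have zK K : {z : tms R m (kap K).*2 | feasible (kap K) z}.
  by apply: cid; have [] := hkap K.
pose z K := projT1 (zK K).
have [U [UU oU]] := free_ultrafilter.
have kap0 K : (0 < kap K)%N by have [/(leq_trans (ltn0Sn _))] := hkap K.
have fz K : feasible (kap K) (z K) by apply: (projT2 (zK K)).
have [l zl] : exists l : multinom m -> R, forall a,
    (fun k => tms_at (z k) a) @ U --> l a.
  by apply: (@feasible_cvg R d m A U UU kap z); apply: filterE => k; split.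
have [Al l0] : moment_functional A l.
  apply: (@feasible_limit R d m A U UU kap z) zl _ _; last exact: filterE.
  move=> K; apply: oU; exists K => // k /= Kk.
  by apply: leq_trans Kk _; have [] := hkap k.
have loc q : localizer q -> op_nonneg l q.
  move=> lq h; apply: l0 => u us.
  by rewrite expr2 !mevalM mulr_ge0 ?localizer_ge0 // -expr2 sqr_ge0.
apply: (@completely_positive_of_functional _ _ l) => //; last first.
- exact: moment_cond_tensor.
- by apply: loc; constructor 3.
by move=> i; apply: loc; constructor 2; exists i.
Qed.

(** An accumulation point is the truncation of a limit functional [l]; as every
    competitor is feasible at each order, [l] minimizes the limit problem. *)
Lemma flat_cluster_points (p : mpoly m R) :
  (msize p <= d1.*2.+1)%N -> ~ multiple_minimizers A (coef_vec d1.*2 p) ->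
  forall zs : (forall k, tms R m k.*2),
    (forall k, (d1 <= k)%N -> @Pk_minimizer R m.+1 d A p k (zs k)) ->
  forall zhat : tms R m d.+1.*2,
    cluster (truncate d.+1.*2 (zs k) @[k --> \oo]) zhat ->
    \rank (moment_mx d.+1 (tms_at zhat)) = \rank (moment_mx d (tms_at zhat)).
Proof.
move=> pd unique zs zmin zhat /cluster_ultrafilter[U [UU oU Uzhat]].
have large K : \forall k \near U, (K <= k)%N by apply: oU; exists K.
have [l zl] : exists l : multinom m -> R, forall a,
    (fun k => tms_at (zs k) a) @ U --> l a.
  apply: (@feasible_cvg R d m A U UU id zs); apply: filterS (large d1) => k dk.
  by split; [exact: leq_trans dk|have [] := zmin k dk].
have ml : moment_functional A l.
  apply: (@feasible_limit R d m A U UU id zs _ zl large).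
  by apply: filterS (large d1) => k dk; have [] := zmin k dk.
have lmin w : moment_functional A w -> pairing p l <= pairing p w.
  move=> mw; apply: cvgr_to_le (cvg_pairing zl (p := p)) _.
  apply: filterS (large d1) => k dk; have [_ kmin] := zmin k dk.
  have k0 : (0 < k)%N by exact: leq_trans dk.
  have dk2 : (d1.*2 <= k.*2)%N by rewrite leq_double.
  have dk' := leq_trans (ltnW (degree_lt_double_order d)) dk2.
  have := kmin _ (feasible_of_functional k0 dk' mw).
  by rewrite pairing_tms_of // (leq_trans pd).
have zl' a : (mdeg a <= d.+1.*2)%N -> tms_at zhat a = l a.
  move=> ad; have ad' : (mdeg a < d.+1.*2.+1)%N by [].
  apply: (@cvg_unique _ _ ((fun k => tms_at (zs k) a) @ U)) => //=.
  have -> : (fun k => tms_at (zs k) a)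
      = (fun k => truncate d.+1.*2 (zs k) 0 (enum_rank (BMultinom ad'))).
    by apply/funext => k; rewrite mxE enum_rankK.
  rewrite /tms_at insubT.
  have cc := @coord_continuous R _ _ 0
    (enum_rank (BMultinom ad' : bmultinom m _)) zhat.
  exact: (cvg_comp _ _ Uzhat cc).
have step := minimizer_step (degree_lt_double_order d) pd unique ml lmin.
rewrite !rank_moment_mx.
have H q : (q <= d.+1)%N -> hankel_mx (tms_at zhat) q q = hankel_mx l q q.
  by move=> qd; apply: eq_hankel_mx => a aq; apply: zl'; lia.
by rewrite !H //; apply: flat_rank.
Qed.

End LimitProblem.

Theorem theorem3p5 (R : realType) (n d : nat) (hn : (2 <= n)%N) (hd : (1 <= d)%N)
    (A : tensor R d n) (hA : symmetric_tensor A) :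
  let d1 := uphalf d.+1 in
  generic_sos n.-1 d1.*2 (fun p : mpoly n.-1 R =>
    (~ completely_positive A ->
       exists K, forall k, (d1 <= k)%N -> (K <= k)%N ->
         ~ exists z : tms R n.-1 k.*2, Pk_feasible A z)
    /\
    (completely_positive A ->
       (forall k, (d1 <= k)%N ->
          exists z : tms R n.-1 k.*2, Pk_minimizer A p z)
       /\
       (forall zs : (forall k, tms R n.-1 k.*2),
          (forall k, (d1 <= k)%N -> Pk_minimizer A p (zs k)) ->
          exists t, [/\ (d1 <= t)%N,
            bounded_set [set truncate t.*2 (zs k) | k in [set k | (t <= k)%N]] &
            forall zhat : tms R n.-1 t.*2,
              cluster (truncate t.*2 (zs k) @[k --> \oo]) zhat ->
              \rank (moment_mx t (tms_at zhat)) =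
              \rank (moment_mx t.-1 (tms_at zhat))]))).
Proof.
case: n hn A hA => // m _ A symA d1.
exists (multiple_minimizers A (e := d1.*2)); first exact: multiple_minimizers_null.
move=> p [_ pd] unique; split; first exact: infeasible_of_not_completely_positive.
move=> cpA; split=> [k dk|zs zmin].
  have k0 : (0 < k)%N by exact: leq_trans dk.
  apply: minimizer_exists => //.
  have [w Aw w0] := completely_positive_functional hd symA cpA.
  have dk2 : (d <= k.*2)%N.
    by rewrite (leq_trans (ltnW (degree_lt_double_order d))) // leq_double.
  by exists (tms_of k.*2 w); apply: (feasible_of_functional k0 dk2).
have d1d : (d1 <= d.+1)%N.
  rewrite /d1 uphalf_half -[X in (_ <= X)%N]odd_double_half leq_add2l.
  by rewrite -addnn leq_addr.
exists d.+1; split=> //; last exact: (flat_cluster_points pd unique zmin).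
exists `|mass A|; split; first exact: num_real.
move=> M /ltW AM _ [k dk <-] /=; apply: le_trans AM.
apply: mx_norm_bound => // i; rewrite mxE.
have d1k : (d1 <= k)%N by exact: leq_trans dk.
apply: feasible_bound; first exact: leq_trans d1k.
by have [] := zmin k d1k.
Qed.
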